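(* Let $0\le\alpha<nd$, let $\omega,\sigma$ be weights on $\mathbb{R}^{d}$, and let $\Phi_{1},\dots,\Phi_{n}\in \mathcal{U}\cap \nabla_{2}$. Let $\Psi \in \widetilde{\mathcal{U}}$, and let $\Phi:\mathbb{R}_{+}\to\mathbb{R}_{+}$ be a bijection such that $\Phi^{-1}=\Phi_{1}^{-1}\times\cdots\times \Phi_{n}^{-1}$ (pointwise product) and $t\mapsto \frac{\Psi(t)}{\Phi(t)}$ is increasing on $\mathbb{R}_{+}^{*}$. Let $\vec{\sigma}=(\sigma,\dots,\sigma)$ ($n$ entries), put $\nu_{\vec{\sigma}}:= \frac{1}{\Phi\left(\prod_{i=1}^{n}\Phi_{i}^{-1}\left(\frac{1}{\sigma}\right)\right)}$ (which equals $\sigma$) and $$[\vec{\sigma},\omega]_{S_{\vec{\Phi},\Psi}^{\alpha}}:=\sup_{Q\in \mathcal{Q}}\Psi \circ \Phi^{-1}\left( \frac{1}{\nu_{\vec{\sigma}}(Q)}\right)\int_Q\Psi\left(\mathcal{M}_\alpha(\sigma\chi_Q,\dots,\sigma\chi_Q)(x)\right)\omega(x)\,dx.$$ Then the following are equivalent: (i) $[\vec{\sigma},\omega]_{S_{\vec{\Phi},\Psi}^{\alpha}}<\infty$; (ii) $\mathcal{M}_{\alpha}(\vec{\sigma}\,\cdot) : L^{\Phi_{1}}(\sigma)\times\cdots\times L^{\Phi_{n}}(\sigma)\to L^{\Psi}(\omega)$ is bounded. Moreover, $$\|\mathcal{M}_{\alpha}(\vec{\sigma}\,\cdot)\|_{\prod_{i=1}^{n}L_{\sigma}^{\Phi_{i}}\rightarrow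 L_{\omega}^{\Psi}} \approx \Psi^{-1}\left([\vec{\sigma}, \omega]_{S_{\vec{\Phi},\Psi}^{\alpha}}\right).$$
   Context: $\mathbb{R}_+=[0,\infty)$, $\mathbb{R}_+^*=(0,\infty)$. $\mathcal{Q}$ is the set of non-degenerate cubes in $\mathbb{R}^d$ with sides parallel to the axes; $|Q|$ is Lebesgue measure. A weight is a locally integrable, almost everywhere positive function $\sigma$ on $\mathbb{R}^d$; $\sigma(E)=\int_E\sigma(x)\,dx$. The multilinear fractional maximal function is, for $0\le\alpha<nd$, $$\mathcal{M}_\alpha(f_1,\dots,f_n)(x):=\sup_{Q\in \mathcal{Q}}|Q|^{\alpha /d}\prod_{i=1}^n\frac{\chi_Q(x)}{|Q|}\int_Q|f_i(y)|\,dy ,$$ and $\mathcal{M}_\alpha(\vec\sigma\,\cdot)$ denotes the operator $(f_1,\dots,f_n)\mapsto\mathcal{M}_\alpha(\sigma f_1,\dots,\sigma f_n)$. A growth function is a function $\Phi:\mathbb{R}_+\to\mathbb{R}_+$, not identically zero, continuous, nondecreasing and onto. It is of upper-type $q>0$ if there is $C_q>0$ with $\Phi(st)\le C_q t^q\Phi(s)$ for all $s>0$, $t\ge 1$. For $q\ge1$, $\mathcal{U}^q$ is the set of growth functions of upper-type $q$ such that $t\mapsto\Phi(t)/t$ is nondecreasing on $\mathbb{R}_+^*$; $\mathcal{U}=\bigcup_{q\ge1}\mathcal{U}^q$. Standing convention: (up to replacing it by an equivalent function) every $\Phi\in\mathcal{U}$ is assumed convex, of class $C^1$, with $\Phi'(t)\approx\Phi(t)/t$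 for $t>0$. $\Phi\in\Delta'$: there is $C>0$ with $\Phi(st)\le C\Phi(s)\Phi(t)$ for all $s,t>0$. $\Phi\in\Delta_2$: there is $K>0$ with $\Phi(2t)\le K\Phi(t)$ for all $t>0$. For a convex growth function $\Phi\in\Delta_2$, $\Phi\in\nabla_2$ means there is $C>0$ with $\int_0^t\frac{\Phi(s)}{s^2}ds\le C\frac{\Phi(t)}{t}$ for all $t>0$. For $q\ge1$, $\widetilde{\mathcal{U}}^q$ is the set of $\Phi\in\mathcal{U}^q\cap\Delta'$ for which there is $C>0$ with $\Phi(s/t)\le C\,\Phi(s)/t^q$ for all $s,t\ge1$; $\widetilde{\mathcal{U}}=\bigcup_{q\ge1}\widetilde{\mathcal{U}}^q$. For $\Phi\in\mathcal{U}$ and a weight $\sigma$, $L^\Phi(\sigma)$ is the set of (classes of) measurable $f:\mathbb{R}^d\to\mathbb{C}$ with $\|f\|_{L^\Phi_\sigma}^{lux}:=\inf\{\lambda>0:\int_{\mathbb{R}^d}\Phi(|f(x)|/\lambda)\sigma(x)dx\le1\}<\infty$. An operator $T:L^{\Phi_1}(\sigma)\times\cdots\times L^{\Phi_n}(\sigma)\to L^\Psi(\omega)$ is bounded if there is $C>0$ with $\|T(f_1,\dots,f_n)\|^{lux}_{L^\Psi_\omega}\le C\prod_{j}\|f_j\|^{lux}_{L^{\Phi_j}_{\sigma}}$ for all $f_j\in L^{\Phi_j}(\sigma)$; its norm is the infimum of such $C$. $A\approx B$ means $c^{-1}B\le A\le cB$ with a constant $c>0$ depending only on $n,\alpha,d,\Psi,\Phi_1,\dots,\Phi_n$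 (not on the weights). *)

(* Defs.v *)
From HB Require Import structures.
From mathcomp Require Import all_boot all_order all_algebra.
From mathcomp Require Import all_classical all_reals all_analysis.
From mathcomp Require Import complex.

Set Implicit Arguments.
Unset Strict Implicit.
Unset Printing Implicit Defensive.
Import Order.TTheory GRing.Theory Num.Theory.
Import numFieldNormedType.Exports.

Local Open Scope classical_set_scope.
Local Open Scope ring_scope.

(* Lebesgue measure on R^d = 'rV[R]_d: the product measure on the Borel sets of
   d.-tuple R (obtained by integrating slices) is extended to an outer measure,
   which is transported to 'rV[R]_d and restricted to its Caratheodory
   measurable sets. These are exactly the Lebesgue measurable sets. *)
Section lebesgue_rV.
Context {R : realType}.
Local Open Scope ereal_scope.

Fixpoint borel_volume (d : nat) : set (d.-tuple R) -> \bar R :=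
  match d with
  | 0%N => fun A => \d_([tuple] : 0.-tuple R) A
  | d'.+1 => fun A => \int[lebesgue_measure]_x
      borel_volume [set t : d'.-tuple R | A [tuple of x :: t]]
  end.

Lemma borel_volume0 d : @borel_volume d set0 = 0.
Proof.
elim: d => [|d IH] /=; first by rewrite diracE in_set0.
by under eq_integral do rewrite IH; rewrite integral0.
Qed.

Lemma borel_volume_ge0 d (A : set (d.-tuple R)) : 0 <= borel_volume A.
Proof.
elim: d A => [|d IH] A /=; first by rewrite diracE lee_fin.
by apply: integral_ge0 => x _; exact: IH.
Qed.

Definition lebesgue_outer (d : nat) (A : set 'rV[R]_d) : \bar R :=
  mu_ext (@borel_volume d) [set t | A (\row_i tnth t i)].

Lemma lebesgue_outer0 d : @lebesgue_outer d set0 = 0.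
Proof. exact: mu_ext0 (borel_volume0 d) (@borel_volume_ge0 d). Qed.

Lemma lebesgue_outer_ge0 d (A : set 'rV[R]_d) : 0 <= lebesgue_outer A.
Proof. exact: mu_ext_ge0 (@borel_volume_ge0 d) _. Qed.

Lemma le_lebesgue_outer d : {homo @lebesgue_outer d : A B / A `<=` B >-> A <= B}.
Proof. by move=> A B AB; apply: le_mu_ext => t; exact: AB. Qed.

Lemma lebesgue_outer_sigma_subadditive d : sigma_subadditive (@lebesgue_outer d).
Proof.
move=> F; rewrite /lebesgue_outer.
exact: (mu_ext_sigma_subadditive (@borel_volume_ge0 d)
  (fun k => [set t : d.-tuple R | F k (\row_i tnth t i)])).
Qed.

HB.instance Definition _ (d : nat) := isOuterMeasure.Build R 'rV[R]_d
  (@lebesgue_outer d) (lebesgue_outer0 d) (@lebesgue_outer_ge0 d)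
  (@le_lebesgue_outer d) (@lebesgue_outer_sigma_subadditive d).

End lebesgue_rV.

(* 'rV[R]_d equipped with the sigma-algebra of Lebesgue measurable sets *)
Notation lebesgue_type R d := (caratheodory_type (@lebesgue_outer R d)).

Definition caratheodory_measure (R : realType) (T : pointedType)
    (mu : {outer_measure set T -> \bar R}) :
    {measure set (caratheodory_type mu) -> \bar R} :=
  (mu : set (caratheodory_type mu) -> \bar R).

Definition lebesgue_rV (R : realType) (d : nat) :
    {measure set (lebesgue_type R d) -> \bar R} :=
  caratheodory_measure (@lebesgue_outer R d).

Section definitions.
Context {R : realType}.
Implicit Types (Phi Psi : R -> R).

Local Notation Rplus := (`[0, +oo[%classic : set R).

(* Functions R_+ -> R_+ are functions R -> R whose values at negative reals are
   irrelevant. *)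
Definition growth_function Phi :=
  [/\ set_fun Rplus Rplus Phi,
      exists t, 0 <= t /\ Phi t != 0,
      {within Rplus, continuous Phi},
      forall s t, 0 <= s -> s <= t -> Phi s <= Phi t
    & set_surj Rplus Rplus Phi].

Definition upper_type (q : R) Phi := exists C : R, 0 < C /\
  forall s t, 0 < s -> 1 <= t -> Phi (s * t) <= C * t `^ q * Phi s.

Definition class_Uq (q : R) Phi :=
  [/\ growth_function Phi, upper_type q Phi &
      forall s t, 0 < s -> s <= t -> Phi s / s <= Phi t / t].

Definition class_U Phi := exists q : R, 1 <= q /\ class_Uq q Phi.

(* Every member of class_U is equivalent to one with these properties. C^1 is
   required on (0, +oo) only: convexity and finiteness at 0 do the rest. *)
Definition normalized Phi :=
  [/\ convex_function Rplus Phi,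
      forall t, 0 < t -> derivable Phi t 1,
      forall t, 0 < t -> {for t, continuous (derive1 Phi)}
    & exists c : R, 0 < c /\ forall t, 0 < t ->
        c^-1 * (Phi t / t) <= derive1 Phi t <= c * (Phi t / t)].

Definition Delta' Phi := exists C : R, 0 < C /\
  forall s t, 0 < s -> 0 < t -> Phi (s * t) <= C * Phi s * Phi t.

Definition Delta2 Phi := exists K : R, 0 < K /\
  forall t, 0 < t -> Phi (2 * t) <= K * Phi t.

Definition nabla2 Phi :=
  [/\ convex_function Rplus Phi, Delta2 Phi & exists C : R, 0 < C /\
    forall t : R, 0 < t ->
      (\int[lebesgue_measure]_(s in `]0%R, t[) (Phi s / s ^+ 2)%:E
        <= (C * (Phi t / t))%:E)%E].

Definition class_tUq (q : R) Phi :=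
  [/\ class_Uq q Phi, Delta' Phi & exists C : R, 0 < C /\
    forall s t, 1 <= s -> 1 <= t -> Phi (s / t) <= C * (Phi s / t `^ q)].

Definition class_tU Phi := exists q : R, 1 <= q /\ class_tUq q Phi.

(* The inverse of a bijection of R_+ onto itself. *)
Definition inv_growth Phi : R -> R := pinv Rplus Phi.

Section euclidean.
Variable d : nat.
Local Notation vec := 'rV[R]_d.
Local Notation leb := (lebesgue_rV R d).

Definition cube (a : vec) (l : R) : set vec :=
  [set x | forall i, a 0 i <= x 0 i <= a 0 i + l].

Definition cubes : set (set vec) :=
  [set Q | exists a l, 0 < l /\ Q = cube a l].

Definition weight (sigma : vec -> R) :=
  [/\ measurable_fun [set: lebesgue_type R d] sigma,
      {ae leb, forall x, 0 < sigma x}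
    & forall K : set vec, compact K ->
        (\int[leb]_(x in K) `|sigma x|%:E < +oo)%E].

Definition weight_measure (sigma : vec -> R) (E : set vec) : \bar R :=
  (\int[leb]_(x in E) (sigma x)%:E)%E.

Definition cabs (f : vec -> R[i]) : vec -> \bar R :=
  fun x => (ComplexField.Normc.normc (f x))%:E.

Definition cmeasurable (f : vec -> R[i]) :=
  measurable_fun [set: lebesgue_type R d] (fun x => complex.Re (f x)) /\
  measurable_fun [set: lebesgue_type R d] (fun x => complex.Im (f x)).

(* |Q| ^ (alpha / d) is a power of the real number fine (leb Q); cubes have
   finite measure. *)
Definition fracmax (n : nat) (alpha : R) (f : 'I_n -> vec -> R[i]) (x : vec) :
    \bar R :=
  ereal_sup [set ((fine (leb Q)) `^ (alpha / d%:R))%:E *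
    \prod_(i < n) ((\1_Q x / fine (leb Q))%:E * \int[leb]_(y in Q) cabs (f i) y)
    | Q in cubes]%E.

Definition scaled_fracmax (n : nat) (alpha : R) (sigma : vec -> R)
    (f : 'I_n -> vec -> R[i]) : vec -> \bar R :=
  fracmax alpha (fun i x => (sigma x)%:C%C * f i x).

(* The Luxemburg norm of a function with modulus g; er_map extends Phi by
   Phi(+oo) = +oo. *)
Definition luxemburg Phi (sigma : vec -> R) (g : vec -> \bar R) : \bar R :=
  ereal_inf [set lam%:E | lam in [set lam : R | 0 < lam /\
    (\int[leb]_x (er_map Phi ((lam^-1)%:E * g x) * (sigma x)%:E) <= 1)%E]].

Definition orlicz Phi (sigma : vec -> R) : set (vec -> R[i]) :=
  [set f | cmeasurable f /\ (luxemburg Phi sigma (cabs f) < +oo)%E].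

(* The functions in the range of T are nonnegative, hence equal to their
   moduli. *)
Definition operator_bounds (n : nat) (T : ('I_n -> vec -> R[i]) -> vec -> \bar R)
    (Phis : 'I_n -> R -> R) (sigma : vec -> R) Psi (omega : vec -> R) : set R :=
  [set C | 0 < C /\ forall f : 'I_n -> vec -> R[i],
    (forall j, orlicz (Phis j) sigma (f j)) ->
    (luxemburg Psi omega (T f) <=
       C%:E * \prod_(j < n) luxemburg (Phis j) sigma (cabs (f j)))%E].

Definition bounded_operator n T Phis sigma Psi omega :=
  exists C, @operator_bounds n T Phis sigma Psi omega C.

Definition operator_norm n T Phis sigma Psi omega : \bar R :=
  ereal_inf [set C%:E | C in @operator_bounds n T Phis sigma Psi omega].

Definition nu (n : nat) (Phis : 'I_n -> R -> R) Phi (sigma : vec -> R) :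
    vec -> R :=
  fun x => 1 / Phi (\prod_(i < n) inv_growth (Phis i) (1 / sigma x)).

Definition sawyer_const (n : nat) (alpha : R) (Phis : 'I_n -> R -> R)
    Phi Psi (sigma omega : vec -> R) : \bar R :=
  ereal_sup [set
    (Psi (inv_growth Phi (1 / fine (weight_measure (nu Phis Phi sigma) Q))))%:E *
    \int[leb]_(x in Q)
      (er_map Psi (fracmax alpha
        (fun (_ : 'I_n) y => (sigma y * \1_Q y)%:C%C) x) * (omega x)%:E)
    | Q in cubes]%E.

End euclidean.
End definitions.

(* Main.v *)
Require Import Defs.
From HB Require Import structures.
From mathcomp Require Import all_boot all_order all_algebra.
From mathcomp Require Import all_classical all_reals all_analysis.
From mathcomp Require Import measurable_realfun complex ring lra.

(** The hypothesis on [Psi] makes it a power up to constants: its last clause at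
    [s = t] bounds [t^q] by [Psi t] for [t >= 1], upper type [q] gives the
    converse, and the arguments [1/t] settle [t < 1] ([class_tU_power]). With
    [h u = (Phi^-1 (1/u))^-q], the Sawyer constant is thus comparable to the
    least [S] such that the integral of [M (sigma 1_Q)^q omega] over [Q] is at
    most [S * h (sigma Q)] for all cubes [Q], and the claim is that the operator
    norm is comparable to [S^(1/q)].

    Necessity ([necessity]) is tested on [f_i = 1_Q]: the Luxemburg norm of
    [1_Q] is at most [1 / Phi_i^-1 (1 / sigma Q)], and these bounds multiply to
    [1 / Phi^-1 (1 / sigma Q)].

    For sufficiency, every cube lies in a comparable cube of one of [2^d] shifted
    dyadic grids ([cube_sub_grid]), so it is enough to bound, uniformly over
    finite subfamilies of one grid, the maximal function
    [max_(Q containing x) b_Q g_Q], where [b_Q = |Q|^(alpha/d - n) sigma(Q)^n]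
    and [g_Q] is the product of the [sigma]-averages of the [f_i] over [Q]. This
    is a Carleson embedding ([carleson_embedding]). Cut the values of [g_Q] at
    the levels [l_k = e 2^(nk)]. Each cube with [g_Q > l_k] lies in a maximal
    one, and by testing a maximal cube [R] contributes at most a constant times
    [l_k^q S * h (sigma R)]. Hoelder's inequality gives
    [g_R <= 2^n Phi^-1 (1 / sigma R)], and [Psi / Phi] is nondecreasing; as
    [l_k < g_R], both together yield
    [l_k^q * h (sigma R) <= C * Phi l_k * sigma R]. The maximal cubes of one
    level are disjoint, and [Phi] at least doubles from each level to the next,
    so that the sum over all levels is at most [2 C] times the [sigma]-integral
    of [Phi (prod_i M_i)], where [M_i] is the maximal function of the averages of
    [f_i]. Finally [Phi (prod_i M_i) <= sum_i Phi_i M_i], and the condition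
    [nabla2] bounds the integral of [Phi_i M_i] by that of [Phi_i f_i]: this is
    Doob's maximal inequality in an Orlicz class ([maximal_orlicz]). Monotone
    convergence passes from finite families of cubes to the whole grid. *)

Set Implicit Arguments.
Unset Strict Implicit.
Unset Printing Implicit Defensive.
Import Order.TTheory GRing.Theory Num.Theory.
Import numFieldNormedType.Exports.

Local Open Scope classical_set_scope.
Local Open Scope ring_scope.

(** * Comparison of integrals of arbitrary functions *)

Section integral_without_measurability.
Context d (T : measurableType d) (R : realType).
Variable mu : {measure set T -> \bar R}.
Local Open Scope ereal_scope.
Import HBNNSimple.

Lemma ae_imply (P Q : T -> Prop) : (forall x, P x -> Q x) ->
  {ae mu, forall x, P x} -> {ae mu, forall x, Q x}.
Proof. by move=> PQ; apply: filterS. Qed.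

Lemma ae_imply2 (P Q S : T -> Prop) : (forall x, P x -> Q x -> S x) ->
  {ae mu, forall x, P x} -> {ae mu, forall x, Q x} -> {ae mu, forall x, S x}.
Proof. by move=> PQS; apply: filterS2. Qed.

Lemma ge0_ae_le_integralT (f g : T -> \bar R) :
  (forall x, 0 <= f x) -> (forall x, 0 <= g x) ->
  {ae mu, forall x, f x <= g x} -> \int[mu]_x f x <= \int[mu]_x g x.
Proof.
move=> f0 g0 [N [mN N0 fgN]]; rewrite !ge0_integralTE//.
apply: ge_ereal_sup => _ [h /= hf <-].
rewrite -integralT_nnsfun (ge0_negligible_integral mN)//; last 2 first.
- by apply/measurable_EFinP; exact: measurable_funP.
- by move=> x _; rewrite lee_fin.
rewrite setTD; have mNC := measurableC mN; rewrite (integral_nnsfun mu mNC h) mrestrict.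
apply: ereal_sup_ubound; exists (proj_nnsfun h mNC) => //= x.
rewrite mindicE; have [xN|xN] := boolP (x \in ~` N); last by rewrite mulr0.
rewrite mulr1; apply: le_trans (hf x) _.
by apply: contrapT => /fgN; move: xN; rewrite inE.
Qed.

(** The integral of a nonnegative function is a supremum over the simple functions
    below it, so comparison holds for arbitrary integrands. It is needed because
    [fracmax] is a supremum over uncountably many closed cubes, whose
    measurability would require a covering theorem. *)
Lemma ae_le_integral (D : set T) (f g : T -> \bar R) :
  {ae mu, forall x, D x -> f x <= g x} ->
  {ae mu, forall x, D x -> 0 <= g x} ->
  \int[mu]_(x in D) f x <= \int[mu]_(x in D) g x.
Proof.
move=> fg g0; rewrite integral_mkcond [leRHS]integral_mkcond.
set F := f \_ D; set G := g \_ D.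
have {}fg : {ae mu, forall x, F x <= G x}.
  apply: filterS fg => x; rewrite /F /G !patchE; case: ifP => // xD; apply.
  by rewrite inE in xD.
have {}g0 : {ae mu, forall x, 0 <= G x}.
  apply: filterS g0 => x; rewrite /G !patchE; case: ifP => // xD; apply.
  by rewrite inE in xD.
rewrite integralE [leRHS]integralE.
apply: (@le_trans _ _ (\int[mu]_x F^\+ x)).
  by rewrite geeDl// oppe_le0 integral_ge0.
have -> : \int[mu]_x G^\- x = 0.
  apply/eqP; rewrite eq_le integral_ge0// andbT.
  rewrite -(integral0 mu setT); apply: ge0_ae_le_integralT => //=.
  by apply: filterS g0 => x Gx0; rewrite funenegE ge_max lexx oppe_le0 Gx0.
rewrite sube0; apply: ge0_ae_le_integralT => //.
by apply: filterS fg => x fgx; rewrite !funeposE ge_max !le_max fgx lexx orbT.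
Qed.

Lemma le_integral_pointwise (D : set T) (f g : T -> \bar R) :
  (forall x, D x -> f x <= g x) -> (forall x, D x -> 0 <= g x) ->
  \int[mu]_(x in D) f x <= \int[mu]_(x in D) g x.
Proof. by move=> fg g0; apply: ae_le_integral; apply: aeW. Qed.

Lemma ge0_integralZl_le (D : set T) (f : T -> \bar R) (k : R) :
  (0 < k)%R -> (forall x, D x -> 0 <= f x) ->
  \int[mu]_(x in D) (k%:E * f x) <= k%:E * \int[mu]_(x in D) f x.
Proof.
move=> k0 f0; rewrite integral_mkcond [in leRHS]integral_mkcond.
have fD0 x : 0 <= (f \_ D) x.
  by rewrite patchE; case: ifPn => //; rewrite inE => /f0.
have kfD0 x : 0 <= ((fun x => k%:E * f x) \_ D) x.
  rewrite patchE; case: ifPn => //; rewrite inE => /f0 fx.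
  by rewrite mule_ge0// lee_fin ltW.
rewrite !ge0_integralTE//.
apply: ge_ereal_sup => _ [h /= hf <-].
have k1 : (0 <= k^-1)%R by rewrite invr_ge0 ltW.
rewrite -lee_pdivrMl//.
pose h' := scale_nnsfun h k1.
apply: ereal_sup_ubound; exists h' => /=.
  move=> x; rewrite /cst/= EFinM lee_pdivrMl//.
  by have := hf x; rewrite !patchE; case: ifP => _ /=; rewrite ?mule0 .
by rewrite sintegralrM.
Qed.

End integral_without_measurability.

(** * Lebesgue measure of boxes *)

Section sigma_finite_structure.
Context d (T : measurableType d) {R : realType}.
Variable m : {measure set T -> \bar R}.
Hypothesis sfm : sigma_finite setT m.

(** A copy of [m] that depends on [sfm], so that the structure of a sigma-finite
    measure can be attached to it inside an induction. *)
Definition as_sigma_finite of sigma_finite setT m : set T -> \bar R := m.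
Local Notation m' := (as_sigma_finite sfm).
HB.instance Definition _ := isMeasure.Build _ _ _ m'
  (measure0 m) (measure_ge0 m) (@measure_semi_sigma_additive _ _ _ m).
HB.instance Definition _ := Measure_isSigmaFinite.Build _ _ _ m' sfm.
End sigma_finite_structure.

Section lebesgue_box.
Context {R : realType}.
Local Open Scope ereal_scope.

Definition tuple_box d (J : 'I_d -> set R) : set (d.-tuple R) :=
  [set t | forall i, J i (tnth t i)].

Lemma measurable_tuple_box d (J : 'I_d -> set R) :
  (forall i, measurable (J i)) -> measurable (tuple_box J).
Proof.
move=> mJ.
have -> : tuple_box J = \bigcap_(i in [set: 'I_d]) ((@tnth _ R ^~ i) @^-1` J i).
  by apply/seteqP; split=> t /= => [Jt i _|Jt i]; exact: Jt.
apply: fin_bigcap_measurable => // i _.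
by rewrite -[X in measurable X]setTI; exact: measurable_tnth.
Qed.

(** The boxes with sides [[-k, k]] exhaust the space and have finite measure. *)
Lemma sigma_finite_box d (m : set (d.-tuple R) -> \bar R) :
  (forall J, (forall i, measurable (J i)) ->
     m (tuple_box J) = \prod_(i < d) lebesgue_measure (J i)) ->
  sigma_finite setT m.
Proof.
move=> mbox; exists (fun k => tuple_box (fun=> `[(- k%:R)%R, k%:R%R]%classic)).
  apply/esym/seteqP; split=> // t _.
  pose M := \big[Num.max/0%R]_(i < d) `|tnth t i|%R.
  exists (Num.truncn M).+1 => // i; rewrite /= in_itv/= -ler_norml.
  apply: (@le_trans _ _ M); first exact: (le_bigmax_cond _ (fun i => `|tnth t i|%R)).
  by rewrite ltW// truncnS_gt.
move=> k; split; first by apply: measurable_tuple_box.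
rewrite mbox// ltey_eq; apply/orP; left; elim/big_ind: _ => //= [x y|i _].
  exact: fin_numM.
by rewrite lebesgue_measure_itv/=; case: ifP => _ //; rewrite -EFinB.
Qed.

(** By induction on the dimension: [borel_volume] is the product of the Lebesgue
    measure of the line and of the volume one dimension lower, transported by
    consing. The formula for boxes is proved along the way because it provides
    the sigma-finiteness that the product measure requires. *)
Lemma tuple_volume d : exists m : {measure set (d.-tuple R) -> \bar R},
  (forall A, measurable A -> m A = borel_volume A) /\
  (forall J, (forall i, measurable (J i)) ->
     m (tuple_box J) = \prod_(i < d) lebesgue_measure (J i)).
Proof.
elim: d => [|d [m [mvol mbox]]].
  exists (\d_([tuple] : 0.-tuple R)); split=> // J mJ.
  have -> : tuple_box J = setT by apply/seteqP; split=> // t _ [].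
  by rewrite big_ord0 /= diracT.
have sfm := sigma_finite_box mbox.
pose m' : {sigma_finite_measure set (d.-tuple R) -> \bar R} := as_sigma_finite sfm.
pose c (p : R * d.-tuple R) : d.+1.-tuple R := [tuple of p.1 :: p.2].
have mc : measurable_fun setT c by apply: measurable_cons.
pose l : {measure set _ -> \bar R} := @lebesgue_measure R.
pose p : {measure set _ -> \bar R} := (l \x m').
exists (pushforward p c); split=> [A mA|J mJ].
  have mcA : measurable (c @^-1` A) by rewrite -[X in measurable X]setTI; exact: mc.
  rewrite /pushforward /p /= /product_measure1; apply: eq_integral => x _ /=.
  have -> : xsection (c @^-1` A) x = [set t : d.-tuple R | A [tuple of (x : R) :: t]].
    by apply/seteqP; split=> t; rewrite /xsection/= inE.
  apply: mvol; rewrite -[X in measurable X]setTI.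
  by apply: (@measurable_cons _ _ _ _ (cst x) _ id) => //; exact: measurable_cst.
rewrite big_ord_recl -mbox => [|i]; last exact: mJ.
have mJ0 := mJ ord0.
rewrite -(product_measure1E l m' mJ0); last exact: measurable_tuple_box.
congr (p _); apply/seteqP; split=> [[x t] /= H|[x t] /= [Jx Jt] i].
  split=> [|i]; first exact: (H ord0).
  by have := H (lift ord0 i); rewrite tnthS.
by case: (unliftP ord0 i) => [j ->|->]//; rewrite tnthS.
Unshelve. all: exact: mc.
Qed.

Definition vec_box d (J : 'I_d -> set R) : set 'rV[R]_d :=
  [set x | forall i, J i (x 0%R i)].

Lemma tuple_of_vec_box d (J : 'I_d -> set R) :
  [set t | vec_box J (\row_i tnth t i)] = tuple_box J.
Proof.
by apply/seteqP; split=> t /= H i; have := H i; rewrite mxE.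
Qed.

Lemma borel_volume_ext d (m : {measure set (d.-tuple R) -> \bar R}) :
  (forall A, measurable A -> m A = borel_volume A) ->
  mu_ext (@borel_volume R d) = mu_ext m.
Proof.
move=> mvol; apply/funext => A; congr ereal_inf; apply/seteqP.
split=> _ [F [mF AF] <-]; exists F => //; apply: eq_eseriesr => k _;
  by rewrite mvol.
Qed.

Lemma lebesgue_box d (J : 'I_d -> set R) : (forall i, measurable (J i)) ->
  lebesgue_rV R d (vec_box J) = \prod_(i < d) lebesgue_measure (J i).
Proof.
move=> mJ; have [m [mvol mbox]] := tuple_volume d.
rewrite /lebesgue_rV /caratheodory_measure /= /lebesgue_outer tuple_of_vec_box.
rewrite (borel_volume_ext mvol) measurable_mu_extE; first exact: mbox.
exact: measurable_tuple_box.
Qed.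

Lemma measurable_vec_box d (J : 'I_d -> set R) : (forall i, measurable (J i)) ->
  (@measurable _ (lebesgue_type R d)) (vec_box J).
Proof.
move=> mJ; have [m [mvol _]] := tuple_volume d.
change (caratheodory_measurable (@lebesgue_outer R d) (vec_box J)).
have := caratheodory_measurable_mu_ext m (measurable_tuple_box mJ).
move=> mB X; have := mB [set t | X (\row_i tnth t i)].
by rewrite /= -(borel_volume_ext mvol) -tuple_of_vec_box.
Qed.

End lebesgue_box.

(** * Cubes and weights *)

Section cubes_and_weights.
Context {R : realType} (d : nat).
Local Notation leb := (lebesgue_rV R d).
Local Notation T := (lebesgue_type R d).
Local Open Scope ereal_scope.

Definition half_open_cube (a : 'rV[R]_d) (l : R) : set T :=
  [set x | forall i, (a 0 i <= x 0 i < a 0 i + l)%R].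

Lemma half_open_cubeE a l :
  half_open_cube a l = vec_box (fun i => `[(a 0 i)%R, (a 0 i + l)%R[%classic).
Proof. by apply/seteqP; split=> x H i; have := H i; rewrite /= in_itv. Qed.

Lemma cubeE (a : 'rV[R]_d) l :
  cube a l = vec_box (fun i => `[(a 0 i)%R, (a 0 i + l)%R]%classic).
Proof. by apply/seteqP; split=> x H i; have := H i; rewrite /= in_itv. Qed.

Lemma measurable_half_open_cube a l : measurable (half_open_cube a l).
Proof. by rewrite half_open_cubeE; apply: measurable_vec_box. Qed.

Lemma measurable_cube (a : 'rV[R]_d) l : measurable (cube a l : set T).
Proof. by rewrite cubeE; apply: measurable_vec_box. Qed.

Lemma prod_itv_length (J : 'I_d -> interval R) (l : R) :
  (forall i, lebesgue_measure [set` J i] = l%:E) ->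
  \prod_(i < d) lebesgue_measure [set` J i] = (l ^+ d)%:E.
Proof.
move=> Jl; under eq_bigr do rewrite Jl.
by rewrite prodEFin prodr_const card_ord.
Qed.

Lemma lebesgue_half_open_cube a l : (0 < l)%R -> leb (half_open_cube a l) = (l ^+ d)%:E.
Proof.
move=> l0; rewrite half_open_cubeE lebesgue_box//.
apply: (prod_itv_length (J := fun i => `[(a 0 i)%R, (a 0 i + l)%R[)) => i.
by rewrite lebesgue_measure_itv/= lte_fin ltrDl l0 -EFinB addrAC subrr add0r.
Qed.

Lemma lebesgue_cube (a : 'rV[R]_d) l : (0 < l)%R -> leb (cube a l) = (l ^+ d)%:E.
Proof.
move=> l0; rewrite cubeE lebesgue_box//.
apply: (prod_itv_length (J := fun i => `[(a 0 i)%R, (a 0 i + l)%R])) => i.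
by rewrite lebesgue_measure_itv/= lte_fin ltrDl l0 -EFinB addrAC subrr add0r.
Qed.

Lemma half_open_cube_sub a l : half_open_cube a l `<=` cube a l.
Proof. by move=> x H i; have /andP[-> /ltW ->] := H i. Qed.

(** The two cubes have the same volume, so they differ by a null set. Closed cubes
    occur in the definition of the maximal operator, half-open ones form nested
    grids. *)
Lemma integral_cube_half_open a l (f : T -> \bar R) : (0 < l)%R ->
  measurable_fun setT f -> (forall x, 0 <= f x) ->
  \int[leb]_(x in cube a l) f x = \int[leb]_(x in half_open_cube a l) f x.
Proof.
move=> l0 mf f0; have mC := measurable_cube a l; have mH := measurable_half_open_cube a l.
have mN : measurable ((cube a l : set T) `\` half_open_cube a l) by exact: measurableD.
have N0 : leb ((cube a l : set T) `\` half_open_cube a l) = 0.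
  have lC := lebesgue_cube a l0; have lH := lebesgue_half_open_cube a l0.
  have lCy : leb (cube a l) < +oo by rewrite lC ltry.
  rewrite (measureD mC mH lCy) setIidr; last exact: half_open_cube_sub.
  transitivity ((l ^+ d)%:E - (l ^+ d)%:E); last by rewrite subee.
  by congr (_ - _).
have mfC : measurable_fun (cube a l : set T) f by exact: measurable_funTS.
rewrite (ge0_negligible_integral mN mC mfC _ N0)//.
by rewrite setDD setIidr//; exact: half_open_cube_sub.
Qed.

Lemma compact_cube (a : 'rV[R]_d) l : compact (cube a l).
Proof.
rewrite cubeE; apply: (@rV_compact _ d (fun i => `[(a 0 i)%R, (a 0 i + l)%R]%classic)) => i.
exact: segment_compact.
Qed.

Variable sigma : 'rV[R]_d -> R.
Hypothesis wsigma : weight sigma.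
Let s (x : T) : R := `|sigma x|%R.

Lemma measurable_abs_weight : measurable_fun setT s.
Proof. by case: wsigma => ms _ _; apply: measurableT_comp. Qed.

Lemma abs_weight_gt0 : {ae leb, forall x, (0 < s x)%R}.
Proof.
case: wsigma => _ + _; apply: ae_imply => x sx; rewrite /s normr_gt0 gt_eqF//.
Qed.

Lemma abs_weightE : {ae leb, forall x, s x = sigma x}.
Proof.
case: wsigma => _ + _; apply: ae_imply => x sx; rewrite /s gtr0_norm//.
Qed.

Lemma weight_cube_fin a l : \int[leb]_(x in cube a l) (s x)%:E < +oo.
Proof. by case: wsigma => _ _ /(_ _ (@compact_cube a l)). Qed.

Lemma weight_half_open_fin a l : \int[leb]_(x in half_open_cube a l) (s x)%:E < +oo.
Proof.
apply: le_lt_trans (weight_cube_fin a l).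
apply: ge0_subset_integral.
- exact: measurable_half_open_cube.
- exact: measurable_cube.
- by apply/measurable_EFinP; apply: measurable_funTS; exact: measurable_abs_weight.
- by move=> x _; rewrite lee_fin normr_ge0.
- exact: half_open_cube_sub.
Qed.

(** A zero integral would make the almost everywhere positive weight vanish almost
    everywhere on a set of positive measure. *)
Lemma weight_half_open_gt0 a l : (0 < l)%R ->
  0 < \int[leb]_(x in half_open_cube a l) (s x)%:E.
Proof.
move=> l0; rewrite lt_def integral_ge0 ?andbT; last first.
  by move=> x _; rewrite lee_fin normr_ge0.
apply/negP => /eqP I0.
have mH := measurable_half_open_cube a l.
have : ae_eq leb (half_open_cube a l) (EFin \o s) (cst 0).
  apply/ae_eq_integral_abs => //.
    by apply/measurable_EFinP; apply: measurable_funTS; exact: measurable_abs_weight.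
  by rewrite -[RHS]I0; apply: eq_integral => x _ /=; rewrite normr_id.
move=> e; have [N [mN N0 HN]] : {ae leb, forall x, ~ half_open_cube a l x}.
  apply: ae_imply2 e abs_weight_gt0 => x Hx sx Dx.
  by have /= [sx0] := Hx Dx; rewrite sx0 ltxx in sx.
have : leb (half_open_cube a l) <= leb N.
  by apply: le_measure; rewrite ?inE// => x Dx; apply: HN; apply.
by rewrite N0 lebesgue_half_open_cube// lee_fin leNgt exprn_gt0.
Qed.

End cubes_and_weights.

(** * Shifted dyadic grids *)

Section dyadic_grids.
Context {R : realType}.
Local Notation two := (2%:R : R).

Lemma exists_pow2 (y : R) : 0 < y -> exists j : int, y < two ^ j <= 2 * y.
Proof.
move=> y0.
have big (z : R) : exists n, z < two ^+ n.
  exists (Num.truncn z).+1; apply: lt_trans (truncnS_gt z) _.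
  by rewrite -natrX ltr_nat ltn_expl.
have [N yN] := big y^-1.
pose P n := y < two ^ (n%:Z - N%:Z).
have exP : exists n, P n.
  have [n yn] := big y; exists (n + N)%N; rewrite /P PoszD addrK.
  exact: yn.
case: (ex_minnP exP) => n Pn minn; exists (n%:Z - N%:Z); rewrite [_ < _]Pn /=.
case: n Pn minn => [|n] Pn minn.
  suff : two ^ (0%:Z - N%:Z) < y by move=> /(lt_trans Pn); rewrite ltxx.
  rewrite sub0r -invr_expz -[ltRHS]invrK ltf_pV2 ?posrE ?invr_gt0 ?exprz_gt0//.
have : ~~ P n by apply/negP => /minn; rewrite ltnn.
rewrite /P -leNgt => Pn'.
rewrite -[n.+1]addn1 PoszD addrAC expfzDr ?pnatr_eq0// expr1z mulrC.
by rewrite ler_pM2l.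
Qed.

(** The shift by one third must change sign from each scale to the next for the
    grid points of a scale to be grid points of all finer scales. *)
Definition grid_sign (j : int) : int := (-1) ^+ `|j|%N.

Lemma grid_signS j : grid_sign (j + 1) = - grid_sign j.
Proof.
rewrite /grid_sign -[RHS]mulN1r; case: j => n.
  by rewrite -PoszD addn1 /= exprS.
case: n => [|n]; first by rewrite /= expr1 mulrNN mulr1.
have -> : Negz n.+1 + 1 = Negz n by rewrite !NegzE -[n.+2]addn1 PoszD opprD addrNK.
by rewrite /= [in RHS]exprS mulrA mulrNN !mul1r.
Qed.

Lemma grid_signP j : grid_sign j = 1 \/ grid_sign j = -1.
Proof. by rewrite /grid_sign -signr_odd; case: odd; [right|left]. Qed.

Definition grid_point (t : bool) (j m : int) : R :=
  two ^ j * (m%:~R + (grid_sign j)%:~R * t%:R / 3).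

Lemma pow2_gt0 (j : int) : 0 < two ^ j.
Proof. by rewrite exprz_gt0. Qed.

Lemma grid_point_le t j m m' : (grid_point t j m <= grid_point t j m') = (m <= m').
Proof. by rewrite /grid_point ler_pM2l ?pow2_gt0// lerD2r ler_int. Qed.

Lemma grid_point_lt t j m m' : (grid_point t j m < grid_point t j m') = (m < m').
Proof. by rewrite !ltNge grid_point_le. Qed.

Lemma grid_pointS t j m : grid_point t j (m + 1) = grid_point t j m + two ^ j.
Proof. by rewrite /grid_point intrD; ring. Qed.

(** Doubling [m + eps t / 3] gives [(2 m + eps t) - eps t / 3]. *)
Lemma grid_point_refine t j (k : nat) m :
  exists m', grid_point t (j + k%:Z) m = grid_point t j m'.
Proof.
elim: k m => [|k IH] m; first by exists m; rewrite addr0.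
have [m' E] := IH (2 * m - grid_sign (j + k%:Z) * t%:R); exists m'; rewrite -E.
rewrite -addn1 PoszD addrA /grid_point grid_signS expfzDr ?pnatr_eq0// expr1z.
rewrite rmorphN rmorphB /= !rmorphM /=.
have -> : ((t%:R : int)%:~R : R) = t%:R by case: (t).
by field.
Qed.

Variable d : nat.
Local Notation T := (lebesgue_type R d).

Definition grid_cube (t : 'I_d -> bool) (j : int) (m : 'I_d -> int) : set T :=
  half_open_cube (\row_i grid_point (t i) j (m i)) (two ^ j).

(** The endpoints of the larger cube are grid points of the finer scale, so in each
    coordinate they cannot fall inside the smaller interval. *)
Lemma grid_cube_sub t j (k : nat) m m' x :
  grid_cube t j m x -> grid_cube t (j + k%:Z) m' x ->
  grid_cube t j m `<=` grid_cube t (j + k%:Z) m'.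
Proof.
move=> xj xk y yj i; move: (xj i) (xk i) (yj i); rewrite !mxE.
rewrite -!grid_pointS.
have [p ->] := grid_point_refine (t i) j k (m' i).
have [p' ->] := grid_point_refine (t i) j k (m' i + 1).
move=> /andP[x1 x2] /andP[x3 x4] /andP[y1 y2]; apply/andP; split.
  apply: le_trans y1; rewrite grid_point_le -ltzD1 -(grid_point_lt (t i) j).
  exact: le_lt_trans x2.
apply: (lt_le_trans y2); rewrite grid_point_le lezD1 -(grid_point_lt (t i) j).
exact: le_lt_trans x4.
Qed.

(** One-third trick: the points of the shifted and of the unshifted grid of a
    given scale are at least a third of that scale apart, so a shorter interval
    cannot meet both of them. *)
Lemma grid_cover_line (j : int) (a l : R) : 0 < l -> 3 * l < two ^ j ->
  exists tm : bool * int, grid_point tm.1 j tm.2 <= a /\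
    a + l < grid_point tm.1 j tm.2 + two ^ j.
Proof.
move=> l0 lj; have L0 := pow2_gt0 j; set L := two ^ j in lj L0 *.
pose m := Num.floor (a / L); pose u := a / L; pose h := l / L.
have m1 : m%:~R <= u by exact: floor_le_tmp.
have m2 : u < m%:~R + 1 by rewrite -intrD1; exact: floorD1_gt.
have h3 : 3 * h < 1 by rewrite /h mulrA ltr_pdivrMr// mul1r.
have h0 : 0 < h by exact: divr_gt0.
have -> : a = L * u by rewrite /u mulrC divfK ?gt_eqF.
have -> : l = L * h by rewrite /h mulrC divfK ?gt_eqF.
suff [tm [H1 H2]] : exists tm : bool * int,
    tm.2%:~R + (grid_sign j)%:~R * tm.1%:R / 3 <= u /\
    u + h < tm.2%:~R + (grid_sign j)%:~R * tm.1%:R / 3 + 1.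
  exists tm; rewrite /grid_point -/L; move: H1 H2; set g := (X in X <= _) => H1 H2.
  split; first by rewrite ler_pM2l.
  by rewrite -[X in _ < _ + X]mulr1 -!mulrDr ltr_pM2l.
(* After scaling, the interval has length [h < 1 / 3]. If it contains the
   unshifted point [m + 1], then it lies in both intervals from [m + 1 / 3] to
   [m + 4 / 3] and from [m + 2 / 3] to [m + 5 / 3]. *)
have [uh|uh] := ltP (u + h) (m%:~R + 1).
  by exists (false, m) => /=; rewrite mulr0 mul0r !addr0.
case: (grid_signP j) => ->.
  by exists (true, m) => /=; split; lra.
exists (true, m + 1) => /=; rewrite intrD; split; lra.
Qed.

Lemma grid_cover (a : 'rV[R]_d) (l : R) : 0 < l ->
  exists t j m, [/\ cube a l `<=` grid_cube t j m, l <= two ^ j & two ^ j <= 6 * l].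
Proof.
move=> l0; have l3 : 0 < 3 * l by exact: mulr_gt0.
have [j /andP[lj jl]] := exists_pow2 l3.
have /choice[tm Htm] i := grid_cover_line (a 0 i) l0 lj.
exists (fun i => (tm i).1), j, (fun i => (tm i).2); split.
- move=> x Qx i; have /andP[x1 x2] := Qx i; have [h1 h2] := Htm i.
  by rewrite !mxE (le_trans h1)// (le_lt_trans x2).
- by apply: le_trans (ltW lj); lra.
- by apply: le_trans jl _; lra.
Qed.

Definition grid_index (i : nat) : int * {ffun 'I_d -> int} :=
  odflt (0, [ffun=> 0]) (unpickle i).

Definition grid (t : 'I_d -> bool) (i : nat) : set T :=
  grid_cube t (grid_index i).1 (grid_index i).2.

Definition grid_side (i : nat) : R := two ^ (grid_index i).1.

Definition grid_corner (t : 'I_d -> bool) (i : nat) : 'rV[R]_d :=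
  \row_k grid_point (t k) (grid_index i).1 ((grid_index i).2 k).

Lemma grid_side_gt0 i : 0 < grid_side i.
Proof. exact: pow2_gt0. Qed.

Lemma grid_nested t i k x : grid t i x -> grid t k x ->
  grid t i `<=` grid t k \/ grid t k `<=` grid t i.
Proof.
rewrite /grid; case: (grid_index i) => j m; case: (grid_index k) => j' m' /=.
move=> xi xk; have [jj|/ltW jj] := leP j j'; [left|right].
  have E : j' = j + `|j' - j|%N by rewrite gez0_abs ?subr_ge0// subrKC.
  by rewrite E in xk *; exact: grid_cube_sub xk.
have E : j = j' + `|j - j'|%N by rewrite gez0_abs ?subr_ge0// subrKC.
by rewrite E in xi *; exact: grid_cube_sub xi.
Qed.

(** The shift is chosen coordinate by coordinate, whence [2^d] grids. *)
Lemma cube_sub_grid (a : 'rV[R]_d) (l : R) : 0 < l ->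
  exists (t : {ffun 'I_d -> bool}) i,
    [/\ cube a l `<=` grid t i, l <= grid_side i & grid_side i <= 6 * l].
Proof.
move=> /(grid_cover a)[t [j [m [Qj lj jl]]]].
exists (finfun t), (pickle (j, finfun m)).
rewrite /grid /grid_side /grid_index pickleK /=; split=> // x /Qj H i.
by have := H i; rewrite !mxE !ffunE.
Qed.

End dyadic_grids.

(** * Growth functions *)

Section growth_functions.
Context {R : realType}.
Local Notation Rplus := (`[0, +oo[%classic : set R).
Implicit Types F : R -> R.

Lemma mem_nonneg (x : R) : (x \in Rplus) = (0 <= x).
Proof.
apply/idP/idP => [/set_mem|x0]; first by rewrite /= in_itv/= andbT.
by apply/mem_set; rewrite /= in_itv/= andbT.
Qed.

Section bijection.
Variable F : R -> R.
Hypothesis bijF : set_bij Rplus Rplus F.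
Local Notation G := (inv_growth F).

Lemma growth_ge0 t : 0 <= t -> 0 <= F t.
Proof.
case: bijF => fF _ _ t0; have := fF t; rewrite /= !in_itv/= !andbT; exact.
Qed.

Lemma inv_growthKV t : 0 <= t -> G (F t) = t.
Proof. by case: bijF => _ iF _ t0; apply: pinvKV => //; rewrite mem_nonneg. Qed.

Lemma inv_growth_surj y : 0 <= y -> exists2 t, 0 <= t & F t = y.
Proof.
case: bijF => _ _ sF y0; have [|t /= t0 Ft] := sF y; first by rewrite /= in_itv/= y0.
by exists t => //; rewrite in_itv/= andbT in t0.
Qed.

Lemma inv_growthK y : 0 <= y -> F (G y) = y.
Proof. by move=> /inv_growth_surj[t t0 <-]; rewrite inv_growthKV. Qed.

Lemma inv_growth_ge0 y : 0 <= y -> 0 <= G y.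
Proof. by move=> /inv_growth_surj[t t0 <-]; rewrite inv_growthKV. Qed.

End bijection.

Section class_U.
Variable F : R -> R.
Hypothesis UF : class_U F.
Local Notation G := (inv_growth F).

Lemma class_U_le s t : 0 <= s -> s <= t -> F s <= F t.
Proof. by case: UF => q [_ [[_ _ _ mF _] _ _]]; exact: mF. Qed.

Lemma class_U_ratio s t : 0 < s -> s <= t -> F s / s <= F t / t.
Proof. by case: UF => q [_ [_ _]]; exact. Qed.

Lemma class_U_doubling k : 1 <= k ->
  exists C, 0 < C /\ forall t, 0 < t -> F (k * t) <= C * F t.
Proof.
move=> k1; case: UF => q [_ [_ [C [C0 FC]] _]].
exists (C * k `^ q); split; first by rewrite mulr_gt0// powR_gt0// (lt_le_trans ltr01).
by move=> t t0; rewrite mulrC; exact: FC.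
Qed.

Lemma class_U_ge0 t : 0 <= t -> 0 <= F t.
Proof.
case: UF => q [_ [[fF _ _ _ _] _ _]] t0.
by have := fF t; rewrite /= !in_itv/= !andbT; exact.
Qed.

Lemma class_U_surj y : 0 <= y -> exists2 t, 0 <= t & F t = y.
Proof.
case: UF => q [_ [[_ _ _ _ sF] _ _]] y0.
have [|t /= t0 Ft] := sF y; first by rewrite /= in_itv/= y0.
by exists t => //; rewrite in_itv/= andbT in t0.
Qed.

Lemma class_U0 : F 0 = 0.
Proof.
have [t t0 Ft] := class_U_surj (lexx 0).
by apply/eqP; rewrite eq_le class_U_ge0// -[in leRHS]Ft class_U_le.
Qed.

(** A zero at a positive point would spread to all larger points by upper type,
    contradicting surjectivity. *)
Lemma class_U_gt0 t : 0 < t -> 0 < F t.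
Proof.
move=> t0; rewrite lt_def class_U_ge0 ?andbT ?ltW//; apply/eqP => Ft0.
have [u u0 Fu] := class_U_surj ler01.
have [ut|tu] := leP u t.
  have := class_U_le u0 ut; rewrite Ft0 Fu; lra.
have [C [C0 FC]] : exists C, 0 < C /\ forall x, 0 < x -> F ((u / t) * x) <= C * F x.
  by apply: class_U_doubling; rewrite ler_pdivlMr// mul1r ltW.
have := FC t t0; rewrite divfK ?gt_eqF// Fu Ft0 mulr0; lra.
Qed.

Lemma class_U_lt s t : 0 <= s -> s < t -> F s < F t.
Proof.
rewrite le_eqVlt => /predU1P[<- t0|s0 st]; first by rewrite class_U0 class_U_gt0.
have t0 := lt_trans s0 st.
have := class_U_ratio s0 (ltW st); rewrite ler_pdivrMr// => /le_lt_trans; apply.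
by rewrite mulrAC ltr_pdivrMr// ltr_pM2l// class_U_gt0.
Qed.

Lemma class_U_bij : set_bij Rplus Rplus F.
Proof.
case: UF => q [_ [[fF _ _ _ sF] _ _]]; split=> // s t; rewrite !mem_nonneg => s0 t0 E.
have [st|ts|//] := ltgtP s t.
  by have := class_U_lt s0 st; rewrite E ltxx.
by have := class_U_lt t0 ts; rewrite E ltxx.
Qed.

Lemma class_U_leV s t : 0 <= s -> 0 <= t -> F s <= F t -> s <= t.
Proof. by move=> s0 t0; apply: contraTT; rewrite -!ltNge; exact: class_U_lt. Qed.

Lemma inv_class_U_le x y : 0 <= x -> x <= y -> G x <= G y.
Proof.
move=> x0 xy; have y0 := le_trans x0 xy; have b := class_U_bij.
by apply: class_U_leV; rewrite ?inv_growth_ge0 ?inv_growthK.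
Qed.

Lemma inv_class_U_gt0 y : 0 < y -> 0 < G y.
Proof.
move=> y0; rewrite lt_def inv_growth_ge0 ?ltW ?andbT//; last exact: class_U_bij.
apply/eqP => E; have := inv_growthK class_U_bij (ltW y0).
by rewrite E class_U0 => H; rewrite H ltxx in y0.
Qed.

(** Dual to the monotonicity of [F t / t]. *)
Lemma inv_class_U_scale k y : 1 <= k -> 0 <= y -> G (k * y) <= k * G y.
Proof.
move=> k1; have k0 : 0 < k := lt_le_trans ltr01 k1; have b := class_U_bij.
rewrite le_eqVlt => /predU1P[<-|y0].
  by rewrite mulr0 -[X in G X]class_U0 inv_growthKV// mulr0.
have Gy0 := inv_class_U_gt0 y0.
have ky0 : 0 <= k * y by rewrite mulr_ge0 ?ltW.
apply: class_U_leV; [exact: inv_growth_ge0|by rewrite mulr_ge0 ?ltW|].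
rewrite (inv_growthK b ky0).
have : F (G y) / G y <= F (k * G y) / (k * G y) by rewrite class_U_ratio// ler_peMl// ltW.
rewrite (inv_growthK b (ltW y0)) ler_pdivlMr ?mulr_gt0//.
have -> : y / G y * (k * G y) = k * y by field; rewrite gt_eqF.
by [].
Qed.

(** Plays the role of Jensen's inequality when averaged: beyond [t] the function
    [F] lies above the line through [0] and [(t, F t)]. *)
Lemma class_U_chord t x : 0 < t -> 0 <= x -> x <= t + t / F t * F x.
Proof.
move=> t0 x0; have Ft := class_U_gt0 t0; have [xt|tx] := leP x t.
  apply: le_trans xt _; rewrite lerDl.
  by rewrite mulr_ge0//; [rewrite divr_ge0// ltW | exact: class_U_ge0].
have x1 := lt_trans t0 tx.
have : x <= t / F t * F x.
  have := class_U_ratio t0 (ltW tx); rewrite ler_pdivlMr// => H.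
  have -> : x = t / F t * (F t / t * x) by field; rewrite !gt_eqF.
  have E : F (t / F t * (F t / t * x)) = F x by congr F; field; rewrite !gt_eqF.
  by rewrite E ler_wpM2l// divr_ge0// ltW.
by move=> H; apply: le_trans H _; rewrite lerDr ltW.
Qed.

Lemma measurable_class_U (d : measure_display) (X : measurableType d)
  (f : X -> R) : (forall x, 0 <= f x) -> measurable_fun setT f ->
  measurable_fun setT (F \o f).
Proof.
move=> f0 mf; have -> : F \o f = (F \o Num.max 0) \o f.
  by apply/funext => x /=; rewrite max_r.
apply: measurableT_comp => //; apply: nondecreasing_measurable => // s t st /=.
apply: class_U_le; first by rewrite le_max lexx.
by rewrite ge_max !le_max lexx st orbT.
Qed.

End class_U.

Section nabla2.
Variable F : R -> R.
Hypotheses (UF : class_U F) (nF : nabla2 F).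
Local Notation phi t := (F t / t).

(** Since [F s / s] is nondecreasing, each of the [m] dyadic intervals between [t]
    and [2^m t] contributes at least [F t / (2 t)] to the integral of [F s / s^2],
    which [nabla2] bounds by [C] times [F (2^m t) / (2^m t)]. Any [m > 4 C] will
    do. *)
Lemma nabla2_lower_index : exists K : R, 1 < K /\
  forall t, 0 < t -> 2 * phi t <= phi (K * t).
Proof.
case: nF => _ _ [C [C0 HC]].
have [m Cm] : exists m : nat, 4 * C < m%:R.
  by exists (Num.truncn (4 * C)).+1; exact: truncnS_gt.
have m0 : (0 < m)%N by rewrite -(ltr_nat R); apply: lt_trans Cm; rewrite mulr_gt0.
exists (2 ^+ m); split; first by rewrite exprn_egt1// -?lt0n// ltr1n.
move=> t t0.
have p0 : 0 < phi t by rewrite divr_gt0// class_U_gt0.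
pose J (j : nat) : set R := `[2 ^+ j * t, 2 ^+ j.+1 * t[%classic.
(* On [J j], [c j] is at most [phi t / s], hence at most [F s / s ^+ 2]. *)
pose c (j : nat) := phi t / (2 ^+ j.+1 * t).
have c0 j : 0 <= c j by rewrite divr_ge0 ?ltW// mulr_gt0// exprn_gt0.
have mJ j : measurable (J j) by exact: measurable_itv.
have step (k : nat) s : \sum_(j < k) c j * \1_(J j) s <=
    if t <= s < 2 ^+ k * t then phi t / s else 0.
  elim: k => [|k IH].
    rewrite big_ord0 expr0 mul1r; case: ifPn => // /andP[ts _].
    by rewrite divr_ge0 ?ltW// (lt_le_trans t0).
  rewrite big_ord_recr/=; have [sk|sk] := ltP s (2 ^+ k * t).
    rewrite indicE memNset ?mulr0 ?addr0; last first.
      by rewrite /J/= in_itv/= => /andP[]; rewrite leNgt sk.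
    apply: le_trans IH _; rewrite sk andbT.
    have -> : s < 2 ^+ k.+1 * t.
      by apply: lt_le_trans sk _; rewrite (ler_wpM2r (ltW t0))// ler_eXn2l ?ltr1n.
    by rewrite andbT.
  rewrite ltNge sk andbF in IH.
  have ts : t <= s by apply: le_trans sk; rewrite ler_peMl ?(ltW t0)// exprn_ege1// ler1n.
  rewrite -[leRHS]add0r lerD// indicE ts /=; case: ifPn => sk1.
    rewrite mem_set; last by rewrite /J/= in_itv/= sk sk1.
    rewrite mulr1 /c (ler_wpM2l (ltW p0))// lef_pV2 ?posrE ?ltW//.
      by rewrite mulr_gt0// exprn_gt0.
    by rewrite (lt_le_trans t0).
  by rewrite memNset ?mulr0// /J/= in_itv/= (negbTE sk1) andbF.
have T0 : 0 < 2 ^+ m * t by rewrite mulr_gt0// exprn_gt0.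
have := HC _ T0; set I := (X in (X <= _)%E -> _) => IC.
suff H : ((m%:R / 2 * phi t)%:E <= I)%E.
  have := le_trans H IC; rewrite lee_fin -ler_pdivrMl// => {}H.
  apply: le_trans H; have -> : C^-1 * (m%:R / 2 * phi t) = C^-1 * (m%:R / 2) * phi t.
    by ring.
  rewrite (ler_wpM2r (ltW p0))// ler_pdivlMl//; lra.
rewrite /I; have -> : m%:R / 2 * phi t = \sum_(j < m) c j * (2 ^+ j * t).
  under eq_bigr => j _.
    have -> : c j * (2 ^+ j * t) = phi t / 2.
      rewrite /c exprS; field; rewrite gt_eqF//= expf_neq0//.
    over.
  by rewrite sumr_const card_ord -mulr_natl; field; rewrite gt_eqF.
rewrite -sumEFin.
have -> : (\sum_(j < m) (c j * (2 ^+ j * t))%:E =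
   \int[lebesgue_measure]_(s in `]0%R, (2 ^+ m * t)%R[)
     (\sum_(j < m) (c j * \1_(J j) s)%:E)%E)%E.
  rewrite ge0_integral_sum//; last 2 first.
  - move=> j; apply/measurable_EFinP.
    by apply: measurable_funM; [exact: measurable_cst|exact: (measurable_indic (mJ j))].
  - by move=> j s _; rewrite lee_fin mulr_ge0.
  apply: eq_bigr => j _.
  under eq_integral do rewrite EFinM.
  rewrite ge0_integralZl_EFin//; last first.
    by apply/measurable_EFinP; exact: (measurable_indic (mJ j)).
  rewrite integral_indic; [|exact: measurable_itv|exact: mJ].
  rewrite setIidl.
    have lJ : lebesgue_measure (J j) = (2 ^+ j * t)%:E.
      rewrite /J lebesgue_measure_itv/= lte_fin ltr_pM2r// ltr_eXn2l ?ltr1n//.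
      by rewrite ltnSn -EFinB; congr EFin; rewrite exprS; ring.
    by rewrite EFinM -lJ.
  move=> s; rewrite /J/= !in_itv/= => /andP[s1 s2]; apply/andP; split.
    by apply: lt_le_trans s1; rewrite mulr_gt0// exprn_gt0.
  by apply: lt_le_trans s2 _; rewrite (ler_wpM2r (ltW t0))// ler_eXn2l ?ltr1n.
apply: le_integral_pointwise => s; rewrite /= in_itv/= => /andP[s0 sT].
  rewrite sumEFin lee_fin; apply: le_trans (step m s) _.
  have Fs0 : 0 <= F s / s ^+ 2 by rewrite divr_ge0 ?exprn_ge0 ?class_U_ge0 ?ltW.
  case: ifPn => // /andP[ts _]; rewrite expr2 invfM mulrA.
  by rewrite ler_wpM2r ?invr_ge0 ?(ltW s0)// class_U_ratio.
by rewrite lee_fin divr_ge0 ?exprn_ge0 ?class_U_ge0 ?ltW.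
Qed.

End nabla2.
End growth_functions.

(** * Products of inverse growth functions and powers *)

Section product_growth.
Context {R : realType}.
Local Notation Rplus := (`[0, +oo[%classic : set R).
Variables (n : nat) (Phis : 'I_n -> R -> R) (Phi : R -> R).
Hypotheses (n_gt0 : (0 < n)%N) (Phis_U : forall i, class_U (Phis i)).
Hypothesis Phi_bij : set_bij Rplus Rplus Phi.
Hypothesis Phi_inv : forall t, 0 <= t ->
  inv_growth Phi t = \prod_(i < n) inv_growth (Phis i) t.
Local Notation G := (inv_growth Phi).

Lemma inv_product_le x y : 0 <= x -> x <= y -> G x <= G y.
Proof.
move=> x0 xy; have y0 := le_trans x0 xy; rewrite !Phi_inv//.
apply: ler_prod => i _; rewrite inv_class_U_le// andbT.
by apply: inv_growth_ge0 => //; exact: class_U_bij.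
Qed.

Lemma inv_product_gt0 y : 0 < y -> 0 < G y.
Proof.
by move=> y0; rewrite Phi_inv ?ltW// prodr_gt0// => i _; exact: inv_class_U_gt0.
Qed.

Lemma inv_product0 : G 0 = 0.
Proof.
rewrite Phi_inv//; case: n n_gt0 Phis Phis_U => // m _ Phis' U'.
rewrite big_ord_recl -[X in inv_growth _ X](class_U0 (U' ord0)).
by rewrite inv_growthKV ?mul0r//; exact: class_U_bij.
Qed.

Lemma product_growth_gt0 t : 0 < t -> 0 < Phi t.
Proof.
move=> t0; rewrite lt_def growth_ge0 ?ltW// andbT; apply/eqP => E.
by have := inv_growthKV Phi_bij (ltW t0); rewrite E inv_product0 => H; rewrite H ltxx in t0.
Qed.

Lemma product_growth_le s t : 0 <= s -> s <= t -> Phi s <= Phi t.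
Proof.
move=> s0 st; have t0 := le_trans s0 st; rewrite leNgt; apply/negP => ts.
have := inv_product_le (growth_ge0 Phi_bij t0) (ltW ts).
rewrite !inv_growthKV// => ts'; have E : s = t by apply/eqP; rewrite eq_le st.
by rewrite E ltxx in ts.
Qed.

Lemma inv_product_scale k y : 1 <= k -> 0 <= y -> G (k * y) <= k ^+ n * G y.
Proof.
move=> k1 y0; have k0 : 0 <= k := le_trans ler01 k1.
rewrite !Phi_inv ?mulr_ge0//.
have -> : k ^+ n = \prod_(i < n) k by rewrite prodr_const card_ord.
rewrite -big_split /=; apply: ler_prod => i _; rewrite inv_class_U_scale// andbT.
by apply: inv_growth_ge0; [exact: class_U_bij|exact: mulr_ge0].
Qed.

(** Dual to the bound [2^n] for the growth of a product of [n] inverse functions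
    when the argument doubles. *)
Lemma product_growth_double t : 0 <= t -> 2 * Phi t <= Phi (2 ^+ n * t).
Proof.
move=> t0; have Pt0 := growth_ge0 Phi_bij t0.
rewrite -[leLHS](inv_growthK Phi_bij) ?mulr_ge0//.
apply: product_growth_le; first by rewrite inv_growth_ge0 ?mulr_ge0.
have k1 : 1 <= 2 :> R by rewrite ler1n.
by have := inv_product_scale k1 Pt0; rewrite inv_growthKV.
Qed.

(** Young's inequality for the product of the inverse functions: every [g i] is at
    most [Phis i ^-1 u] with [u] the right-hand side. *)
Lemma product_growth_prod (g : 'I_n -> R) : (forall i, 0 <= g i) ->
  Phi (\prod_(i < n) g i) <= \sum_(i < n) Phis i (g i).
Proof.
move=> g0; set u := \sum_(i < n) _.
have P0 i : 0 <= Phis i (g i) by exact: class_U_ge0.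
have u0 : 0 <= u by exact: sumr_ge0.
rewrite -[leRHS](inv_growthK Phi_bij u0).
apply: product_growth_le; first exact: prodr_ge0.
rewrite Phi_inv//; apply: ler_prod => i _; rewrite g0 /=.
rewrite -[leLHS](inv_growthKV (class_U_bij (Phis_U i)) (g0 i)).
apply: inv_class_U_le => //; rewrite /u (bigD1 i)//= lerDl.
by apply: sumr_ge0.
Qed.

End product_growth.

Section power_growth.
Context {R : realType}.
Variable Psi : R -> R.

Lemma class_tU_class_U : class_tU Psi -> class_U Psi.
Proof. by move=> [q [q1 [UPsi _ _]]]; exists q. Qed.

(** For [t >= 1] the last condition of [class_tUq] at [s = t] gives the lower bound
    and upper type the upper one; for [t < 1] the roles are exchanged, applied
    to [t^-1]. *)
Lemma class_tU_power : class_tU Psi -> exists q c : R, [/\ 1 <= q, 0 < c &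
  forall t, 0 <= t -> t `^ q <= c * Psi t /\ Psi t <= c * t `^ q].
Proof.
move=> tU; have U := class_tU_class_U tU.
case: tU => q [q1 [[_ [C1 [C10 H1]] _] _ [C2 [C20 H2]]]].
have K0 : 0 < Psi 1 by apply: class_U_gt0.
set K := Psi 1 in K0; set C := C1 + C2.
have C0 : 0 < C by rewrite addr_gt0.
have q0 : q != 0 by rewrite gt_eqF// (lt_le_trans ltr01).
exists q, (C * K + C / K); split=> //.
  by rewrite addr_gt0 ?mulr_gt0 ?invr_gt0.
suff main t : 0 < t -> t `^ q <= C / K * Psi t /\ Psi t <= C * K * t `^ q.
  move=> t; rewrite le_eqVlt => /predU1P[<-|t0].
    by rewrite class_U0// powR0// !mulr0.
  have [h1 h2] := main t t0; have p0 := class_U_gt0 U t0.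
  have r0 : 0 < t `^ q by exact: powR_gt0.
  split.
    apply: le_trans h1 _; rewrite (ler_wpM2r (ltW p0))// lerDr.
    by rewrite mulr_ge0 ?ltW.
  by apply: le_trans h2 _; rewrite (ler_wpM2r (ltW r0))// lerDl divr_ge0 ?ltW.
move=> t0; have p0 := class_U_gt0 U t0; have r0 : 0 < t `^ q by exact: powR_gt0.
have C1C : C1 <= C by rewrite lerDl ltW.
have C2C : C2 <= C by rewrite lerDr ltW.
have [t1|t1] := leP 1 t.
  split.
    have := H2 t t t1 t1; rewrite divff ?gt_eqF// -/K mulrA ler_pdivlMr//.
    rewrite mulrC -ler_pdivlMr// => h; apply: le_trans h _.
    by rewrite mulrAC (ler_wpM2r (ltW p0))// ler_pM2r ?invr_gt0.
  have := H1 1 t ltr01 t1; rewrite mul1r -/K => h; apply: le_trans h _.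
  by rewrite mulrAC (ler_wpM2r (ltW r0))// ler_pM2r.
have u1 : 1 <= t^-1 by rewrite invf_ge1// ltW.
have E : t^-1 `^ q = (t `^ q)^-1 by rewrite -[t^-1]powR_inv1 ?ltW// -powRrM mulN1r powRN.
split.
  have := H1 t t^-1 t0 u1; rewrite divff ?gt_eqF// -/K E mulrAC ler_pdivlMr//.
  rewrite mulrC -ler_pdivlMr// => h; apply: le_trans h _.
  by rewrite mulrAC (ler_wpM2r (ltW p0))// ler_pM2r ?invr_gt0.
have := H2 1 t^-1 (lexx 1) u1; rewrite E !invrK mul1r -/K mulrA => h; apply: le_trans h _.
by rewrite (ler_wpM2r (ltW r0))// ler_pM2r.
Qed.

End power_growth.

Section power_vs_product.
Context {R : realType}.
Local Notation Rplus := (`[0, +oo[%classic : set R).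
Variables (n : nat) (Phis : 'I_n -> R -> R) (Phi Psi : R -> R).
Hypotheses (n_gt0 : (0 < n)%N) (Phis_U : forall i, class_U (Phis i)).
Hypothesis Phi_bij : set_bij Rplus Rplus Phi.
Hypothesis Phi_inv : forall t, 0 <= t ->
  inv_growth Phi t = \prod_(i < n) inv_growth (Phis i) t.
Hypothesis PsiPhi : forall s t, 0 < s -> s <= t -> Psi s / Phi s <= Psi t / Phi t.
Variables (q c : R).
Hypothesis c0 : 0 < c.
Hypothesis Psi_q : forall t, 0 <= t -> t `^ q <= c * Psi t /\ Psi t <= c * t `^ q.

(** [t^q / Phi t] is comparable to the nondecreasing function [Psi t / Phi t]. *)
Lemma power_product_ratio s t : 0 < s -> s <= t ->
  s `^ q * Phi t <= c ^+ 2 * (t `^ q * Phi s).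
Proof.
move=> s0 st; have t0 := lt_le_trans s0 st.
have Ps := product_growth_gt0 n_gt0 Phis_U Phi_bij Phi_inv s0.
have Pt := product_growth_gt0 n_gt0 Phis_U Phi_bij Phi_inv t0.
have [h1 _] := Psi_q (ltW s0); have [_ h2] := Psi_q (ltW t0).
have := PsiPhi s0 st; rewrite ler_pdivrMr// mulrAC ler_pdivlMr// => h.
apply: (@le_trans _ _ (c * Psi s * Phi t)); first by rewrite ler_pM2r.
apply: (@le_trans _ _ (c * (Psi t * Phi s))).
  by rewrite -mulrA ler_pM2l.
by rewrite expr2 -[c * c * _]mulrA ler_pM2l// mulrA ler_pM2r.
Qed.

(** The form in which the monotonicity of [Psi / Phi] enters: [l] is a level and
    [v] the value of [Phi^-1 (1 / sigma R)] for a maximal cube [R] of that level,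
    and Hoelder's inequality only gives [l <= 2^n v]. *)
Lemma power_product_le l v : 0 < l -> 0 < v -> l <= 2 ^+ n * v ->
  l `^ q * Phi v <= c ^+ 2 * (2 ^+ n) `^ q * (v `^ q * Phi l).
Proof.
move=> l0 v0 lv; have n0 : 0 < (2 ^+ n : R) by exact: exprn_gt0.
have l'0 : 0 < l / 2 ^+ n by exact: divr_gt0.
have l'v : l / 2 ^+ n <= v by rewrite ler_pdivrMr// mulrC.
have := power_product_ratio l'0 l'v.
have -> : l `^ q = (l / 2 ^+ n) `^ q * (2 ^+ n) `^ q.
  by rewrite -powRM ?ltW// divfK ?gt_eqF.
move=> h; set X := (2 ^+ n) `^ q; have X0 : 0 < X by exact: powR_gt0.
set A := (l / 2 ^+ n) `^ q in h *; set B := v `^ q in h *.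
have -> : A * X * Phi v = A * Phi v * X by ring.
have -> : c ^+ 2 * X * (B * Phi l) = c ^+ 2 * (B * Phi l) * X by ring.
rewrite ler_pM2r//; apply: le_trans h _; rewrite ler_pM2l ?exprn_gt0//.
rewrite (ler_wpM2l (powR_ge0 _ _))//.
apply: (product_growth_le Phis_U Phi_bij Phi_inv); first exact: ltW.
by rewrite ler_pdivrMr// ler_peMr ?(ltW l0)// exprn_ege1// ler1n.
Qed.

End power_vs_product.

(** * Finite maxima and geometric levels *)

Section finite_maxima_and_levels.
Context {R : realType}.

Lemma bigmax0_attained (I : finType) (P : pred I) (h : I -> R) :
  0 < \big[Num.max/0]_(i | P i) h i ->
  exists2 i, P i & \big[Num.max/0]_(i | P i) h i = h i.
Proof.
suff : \big[Num.max/0]_(i | P i) h i = 0 \/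
    exists2 i, P i & \big[Num.max/0]_(i | P i) h i = h i.
  by case=> // ->; rewrite ltxx.
apply: (big_ind (fun y => y = 0 \/ exists2 i, P i & y = h i)).
- by left.
- by move=> x y Hx Hy; rewrite maxEle; case: ifP.
- by move=> i Pi; right; exists i.
Qed.

Lemma bigmax0_ge0 (I : finType) (P : pred I) (h : I -> R) :
  0 <= \big[Num.max/0]_(i | P i) h i.
Proof. exact: bigmax_ge_id. Qed.

Lemma le_bigmax0 (I : finType) (P : pred I) (h : I -> R) i : P i ->
  h i <= \big[Num.max/0]_(i | P i) h i.
Proof. by move=> Pi; exact: le_bigmax_cond. Qed.

Lemma measurable_bigmax d (T : measurableType d) (I : Type) (r : seq I)
    (P : pred I) (h : I -> T -> R) :
  (forall i, measurable_fun setT (h i)) ->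
  measurable_fun setT (fun x => \big[Num.max/0]_(i <- r | P i) h i x).
Proof.
move=> mh; elim: r => [|i r IH].
  by under eq_fun do rewrite big_nil; exact: measurable_cst.
under eq_fun do rewrite big_cons; case: (P i) => //.
exact: measurable_maxr.
Qed.

Lemma measurable_bigsum d (T : measurableType d) (I : Type) (r : seq I)
    (P : pred I) (h : I -> T -> R) :
  (forall i, measurable_fun setT (h i)) ->
  measurable_fun setT (fun x => \sum_(i <- r | P i) h i x).
Proof.
move=> mh; elim: r => [|i r IH].
  by under eq_fun do rewrite big_nil; exact: measurable_cst.
under eq_fun do rewrite big_cons; case: (P i) => //.
exact: measurable_funD.
Qed.

Lemma exists_pow_ge (K y : R) : 1 < K -> exists m, y <= K ^+ m.
Proof.
move=> K1; have e0 : 0 < K - 1 by rewrite subr_gt0.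
have bern (m : nat) : 1 + m%:R * (K - 1) <= K ^+ m.
  elim: m => [|m IH]; first by rewrite mul0r addr0.
  have Km : 1 <= K ^+ m by rewrite exprn_ege1// ltW.
  have h : K - 1 <= (K - 1) * K ^+ m by rewrite ler_peMr// ltW.
  have -> : K ^+ m.+1 = K ^+ m + (K - 1) * K ^+ m by rewrite exprS; ring.
  by rewrite -natr1 mulrDl mul1r addrA lerD.
exists (Num.truncn (y / (K - 1))).+1; apply: le_trans (bern _).
have := truncnS_gt (y / (K - 1)); rewrite ltr_pdivrMr// => h.
by rewrite ltW// (lt_trans h)// ltrDr.
Qed.

(** Finitely many positive values lie in finitely many levels of ratio [K], so that
    all the sums over levels below are finite. *)
Lemma geometric_range (I : finType) (a : I -> R) (K : R) : 1 < K ->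
  (forall i, 0 <= a i) ->
  exists e m, 0 < e /\ forall i, 0 < a i -> e < a i <= e * K ^+ m.
Proof.
move=> K1 a0; pose e := (1 + \sum_i (a i)^-1)^-1.
have s0 : 0 <= \sum_i (a i)^-1 by apply: sumr_ge0 => i _; rewrite invr_ge0.
have S1 : 0 < 1 + \sum_i (a i)^-1 by rewrite ltr_pwDl.
have e0 : 0 < e by rewrite invr_gt0.
have [m Hm] := exists_pow_ge ((\sum_i a i) / e) K1.
exists e, m; split=> // i ai; apply/andP; split.
  rewrite -[ltRHS]invrK ltf_pV2 ?posrE ?invr_gt0// (bigD1 i)//=.
  by rewrite addrCA ltrDl ltr_pwDl// sumr_ge0// => k _; rewrite invr_ge0.
rewrite mulrC -ler_pdivrMr//; apply: le_trans Hm.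
rewrite (bigD1 i)//= ler_pM2r ?invr_gt0// lerDl.
by apply: sumr_ge0.
Qed.

Lemma geometric_level (e K y : R) m : e < y -> y <= e * K ^+ m ->
  exists2 k, (k < m)%N & e * K ^+ k < y <= e * K ^+ k.+1.
Proof.
elim: m => [|m IH] ey; first by rewrite expr0 mulr1 leNgt ey.
have [ym _|my ym] := leP y (e * K ^+ m).
  by have [k km H] := IH ey ym; exists k => //; exact: ltnW.
by exists m => //; rewrite my.
Qed.

(** A geometric sum is comparable to its last term. *)
Lemma geometric_sum_le (F : R -> R) (A e t : R) m : 0 < e -> 0 < A ->
  (forall t, 0 < t -> 0 <= F t) ->
  (forall s t, 0 < s -> s <= t -> F s <= F t) ->
  (forall t, 0 < t -> 2 * F t <= F (A * t)) -> 0 < t ->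
  \sum_(k < m) F (e * A ^+ k) * (e * A ^+ k < t)%R%:R <= 2 * F t.
Proof.
move=> e0 A0 F0 Fle F2 t0.
have l0 k : 0 < e * A ^+ k by rewrite mulr_gt0// exprn_gt0.
have full k : \sum_(j < k.+1) F (e * A ^+ j) <= 2 * F (e * A ^+ k).
  elim: k => [|k IH].
    by rewrite big_ord1 expr0 mulr1 ler_peMl ?F0// ler1n.
  rewrite big_ord_recr /=; have := F2 _ (l0 k).
  rewrite mulrCA -exprS => h; have := F0 _ (l0 k.+1); lra.
elim: m => [|m IH]; first by rewrite big_ord0 mulr_ge0// F0.
rewrite big_ord_recr /=; have [lt|ge] := ltP (e * A ^+ m) t; last by rewrite mulr0 addr0.
apply: (@le_trans _ _ (\sum_(j < m.+1) F (e * A ^+ j))).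
  rewrite big_ord_recr /= mulr1 lerD2r; apply: ler_sum => k _.
  by case: (e * A ^+ k < t); rewrite ?mulr1// mulr0 F0.
apply: le_trans (full m) _; rewrite ler_pM2l//.
by apply: Fle => //; rewrite ltW.
Qed.

End finite_maxima_and_levels.

(** * Integrals against a weight *)

Section weighted_integral.
Context d (T : measurableType d) {R : realType}.
Variable mu : {measure set T -> \bar R}.
Variable s : T -> R.
Hypotheses (ms : measurable_fun setT s) (s0 : forall x, 0 <= s x).

Definition wintegral (g : T -> R) : \bar R := (\int[mu]_x (g x * s x)%:E)%E.

Lemma wintegral_ge0 (g : T -> R) : (forall x, 0 <= g x) -> (0 <= wintegral g)%E.
Proof. by move=> g0; apply: integral_ge0 => x _; rewrite lee_fin mulr_ge0. Qed.

Lemma wintegral_le (g h : T -> R) : (forall x, g x <= h x) -> (forall x, 0 <= h x) ->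
  (wintegral g <= wintegral h)%E.
Proof.
move=> gh h0; apply: le_integral_pointwise => x _; rewrite lee_fin ?mulr_ge0//.
exact: ler_wpM2r.
Qed.

Lemma wintegral_sum (J : Type) (r : seq J) (P : pred J) (c : J -> R) (g : J -> T -> R) :
  (forall j, 0 <= c j) -> (forall j x, 0 <= g j x) ->
  (forall j, measurable_fun setT (g j)) ->
  wintegral (fun x => \sum_(j <- r | P j) c j * g j x) =
  (\sum_(j <- r | P j) (c j)%:E * wintegral (g j))%E.
Proof.
move=> c0 g0 mg; rewrite /wintegral.
transitivity (\int[mu]_x (\sum_(j <- [seq j <- r | P j]) (c j * (g j x * s x))%:E))%E.
  apply: eq_integral => x _; rewrite sumEFin big_filter mulr_suml.
  by congr EFin; apply: eq_bigr => j _; rewrite mulrA.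
rewrite ge0_integral_sum//; last 2 first.
- move=> j; apply/measurable_EFinP; apply: measurable_funM; first exact: measurable_cst.
  exact: measurable_funM.
- by move=> j x _; rewrite lee_fin !mulr_ge0.
rewrite big_filter; apply: eq_bigr => j _.
under eq_integral do rewrite EFinM.
rewrite ge0_integralZl_EFin//; first by move=> x _; rewrite lee_fin mulr_ge0.
by apply/measurable_EFinP; exact: measurable_funM.
Qed.

Lemma wintegralZ (k : R) (g : T -> R) : 0 <= k -> (forall x, 0 <= g x) ->
  measurable_fun setT g ->
  wintegral (fun x => k * g x) = (k%:E * wintegral g)%E.
Proof.
move=> k0 g0 mg.
have := @wintegral_sum unit [:: tt] xpredT (fun=> k) (fun=> g)
  (fun=> k0) (fun=> g0) (fun=> mg).
by rewrite big_seq1 => <-; congr wintegral; apply/funext => x; rewrite big_seq1.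
Qed.

Lemma wintegralD (g h : T -> R) : (forall x, 0 <= g x) -> (forall x, 0 <= h x) ->
  measurable_fun setT g -> measurable_fun setT h ->
  wintegral (fun x => g x + h x) = (wintegral g + wintegral h)%E.
Proof.
move=> g0 h0 mg mh.
have := @wintegral_sum bool [:: true; false] xpredT (fun=> 1)
  (fun b => if b then g else h)
  (fun=> ler01).
rewrite big_cons big_seq1 !mul1e => <-; last 2 first.
- by case.
- by case.
by congr wintegral; apply/funext => x; rewrite big_cons big_seq1 !mul1r.
Qed.

Lemma wintegral_indic (A : set T) : measurable A ->
  wintegral \1_A = (\int[mu]_(x in A) (s x)%:E)%E.
Proof.
move=> mA; rewrite integral_mkcond; apply: eq_integral => x _.
by rewrite patchE indicE; case: ifP => _; rewrite ?mul1r ?mul0r.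
Qed.

End weighted_integral.

(** * Maximal sets of a nested family *)

Section nested_sets.
Context (T : Type) (I : finType) (Q : I -> set T).
Hypothesis nested : forall i k x, Q i x -> Q k x -> Q i `<=` Q k \/ Q k `<=` Q i.

(** Induction on the family: a new set is either contained in a selected one, or it
    replaces the selected sets that it contains. Choosing by induction copes with
    repeated sets, which have no unique maximal index. *)
Lemma maximal_disjoint (P : pred I) : exists M : {set I},
  [/\ forall i, i \in M -> P i,
      forall i k x, i \in M -> k \in M -> Q i x -> Q k x -> i = k
    & forall i, P i -> exists2 k, k \in M & Q i `<=` Q k].
Proof.
suff H (r : seq I) : exists M : {set I},
    [/\ forall i, i \in M -> i \in r,
        forall i k x, i \in M -> k \in M -> Q i x -> Q k x -> i = k
      & forall i, i \in r -> exists2 k, k \in M & Q i `<=` Q k].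
  have [M [M1 M2 M3]] := H (enum P); exists M; split=> // i.
    by move=> /M1; rewrite mem_enum.
  by move=> Pi; apply: M3; rewrite mem_enum.
elim: r => [|i r [M [M1 M2 M3]]].
  by exists finset.set0; split=> // i; rewrite inE.
have [[k kM ik]|noM] := pselect (exists2 k, k \in M & Q i `<=` Q k).
  exists M; split=> // j.
    by move=> /M1; rewrite inE orbC => ->.
  by rewrite inE => /predU1P[->|/M3//]; exists k.
exists (i |: [set k in M | ~~ `[< Q k `<=` Q i >]])%SET; split.
- by move=> j; rewrite !inE => /predU1P[->|/andP[/M1 -> _]]; rewrite ?eqxx ?orbT.
- move=> j k x; rewrite !inE => /predU1P[->|/andP[jM /asboolPn ji]].
    move=> /predU1P[->//|/andP[kM /asboolPn ki]] ix kx.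
    by have [ik|//] := nested ix kx; exfalso; apply: noM; exists k.
  move=> /predU1P[->|/andP[kM _]] jx kx; last exact: M2 kx.
  by have [//|ij] := nested jx kx; exfalso; apply: noM; exists j.
- move=> j; rewrite inE => /predU1P[->|jr].
    by exists i => //; rewrite !inE eqxx.
  have [k kM jk] := M3 _ jr; have [ki|ki] := pselect (Q k `<=` Q i).
    by exists i; [rewrite !inE eqxx|exact: subset_trans ki].
  by exists k => //; rewrite !inE kM; apply/orP; right; apply/asboolPn.
Qed.

End nested_sets.

(** * The maximal inequality in an Orlicz class *)

Section orlicz_maximal.
Context d (T : measurableType d) {R : realType}.
Variable mu : {measure set T -> \bar R}.
Variables (s : T -> R).
Hypotheses (ms : measurable_fun setT s) (s0 : forall x, 0 <= s x).
Variables (I : finType) (Q : I -> set T) (sQ : I -> R).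
Hypothesis mQ : forall i, measurable (Q i).
Hypothesis nested : forall i k x, Q i x -> Q k x -> Q i `<=` Q k \/ Q k `<=` Q i.
Hypotheses (sQ0 : forall i, 0 < sQ i)
  (sQE : forall i, wintegral mu s \1_(Q i) = (sQ i)%:E).
Local Notation ws := (wintegral mu s).

Lemma indic01 (A : set T) x : 0 <= (\1_A x : R) <= 1.
Proof. by rewrite indicE; case: (_ \in _); rewrite ?lexx ?ler01. Qed.

Lemma indic_ge0 (A : set T) x : 0 <= (\1_A x : R).
Proof. by case/andP: (indic01 A x). Qed.

Lemma indic1 (A : set T) x : A x -> (\1_A x : R) = 1.
Proof. by move=> Ax; rewrite indicE mem_set. Qed.

Lemma indic_pos (A : set T) x : 0 < (\1_A x : R) -> A x.
Proof.
by rewrite indicE; case: (boolP (x \in A)) => [/set_mem//|_]; rewrite ltxx.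
Qed.

(** At most one term of the sum is nonzero. *)
Lemma sum_indic_disjoint (M : {set I}) (c b : R) x : 0 <= c -> 0 <= b ->
  (forall i k x, i \in M -> k \in M -> Q i x -> Q k x -> i = k) ->
  (forall i, i \in M -> Q i x -> c <= b) ->
  \sum_(i in M) c * \1_(Q i) x <= b.
Proof.
move=> c0 b0 disj cb.
have [[k kM kx]|none] := pselect (exists2 k, k \in M & Q k x).
  rewrite (bigD1 k)//= indic1// mulr1 big1 ?addr0; first exact: cb kx.
  move=> i /andP[iM ik]; rewrite indicE memNset ?mulr0// => ix.
  by move/eqP: ik; apply; exact: disj ix kx.
rewrite big1// => i iM; rewrite indicE memNset ?mulr0// => ix.
by apply: none; exists i.
Qed.

(** Hoelder's inequality: integrate [class_U_chord] over [Q i] at the point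
    [F^-1 (1 / sQ i)], where both terms have the same bound. *)
Lemma average_le (F : R -> R) (f : T -> R) i : class_U F ->
  (forall x, 0 <= f x) -> measurable_fun setT f -> (ws (F \o f) <= 1)%E ->
  (ws (fun x => \1_(Q i) x * f x)%R <=
     (2 * inv_growth F (sQ i)^-1 * sQ i)%:E)%E.
Proof.
move=> UF f0 mf Ff; set t := inv_growth F _.
have u0 : 0 < (sQ i)^-1 by rewrite invr_gt0.
have t0 : 0 < t by exact: inv_class_U_gt0.
have Ft : F t = (sQ i)^-1 by rewrite inv_growthK ?ltW//; exact: class_U_bij.
have mFf : measurable_fun setT (F \o f) by exact: measurable_class_U.
have Ff0 x : 0 <= (F \o f) x by exact: class_U_ge0.
have tF0 : 0 <= t / F t by rewrite Ft invrK mulr_ge0 ?ltW.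
apply: (@le_trans _ _ (ws (fun x => t * \1_(Q i) x + t / F t * (F \o f) x))).
  apply: wintegral_le => // x; last by rewrite addr_ge0// mulr_ge0 ?indic_ge0// ltW.
  have [Qx|Qx] := pselect (Q i x).
    by rewrite indic1// mul1r mulr1 class_U_chord.
  by rewrite indicE memNset// mul0r mulr0 add0r mulr_ge0.
have mI : measurable_fun setT (\1_(Q i) : T -> R) by exact: measurable_indic.
have I0 x : 0 <= (\1_(Q i) x : R) by exact: indic_ge0.
have g0 x : 0 <= t * \1_(Q i) x by rewrite mulr_ge0// ltW.
have h0 x : 0 <= t / F t * (F \o f) x by rewrite mulr_ge0.
have mg : measurable_fun setT (fun x => t * \1_(Q i) x).
  by apply: measurable_funM; first exact: measurable_cst.
have mh : measurable_fun setT (fun x => t / F t * (F \o f) x).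
  by apply: measurable_funM; first exact: measurable_cst.
rewrite (wintegralD mu ms s0 g0 h0 mg mh).
rewrite (wintegralZ mu ms s0 (ltW t0) I0 mI) (wintegralZ mu ms s0 tF0 Ff0 mFf).
rewrite sQE Ft invrK -mulrA mulr_natl mulr2n EFinD.
rewrite -EFinM; apply: leeD => //.
by rewrite -[leRHS]mule1; apply: lee_wpmul2l => //; rewrite lee_fin mulr_ge0 ?ltW.
Qed.

Variable f : T -> R.
Hypotheses (f0 : forall x, 0 <= f x) (mf : measurable_fun setT f).
Variable fQ : I -> R.
Hypothesis fQE : forall i, ws (fun x => \1_(Q i) x * f x) = (fQ i)%:E.
Local Notation a i := (fQ i / sQ i).
Local Notation Mf x := (\big[Num.max/0]_i (a i * \1_(Q i) x)).

Lemma fQ_ge0 i : 0 <= fQ i.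
Proof.
rewrite -lee_fin -fQE; apply: wintegral_ge0 => // x.
by rewrite mulr_ge0 ?indic_ge0.
Qed.

Lemma average_ge0 i : 0 <= a i.
Proof. by rewrite divr_ge0 ?fQ_ge0// ltW. Qed.

Lemma measurable_maximal : measurable_fun setT (fun x => Mf x).
Proof.
apply: measurable_bigmax => i.
by apply: measurable_funM; [exact: measurable_cst|exact: measurable_indic].
Qed.

Lemma measurable_level (g : T -> R) (l : R) : measurable_fun setT g ->
  measurable [set x | l < g x].
Proof.
move=> mg; have -> : [set x | l < g x] = setT `&` g @^-1` `]l, +oo[%classic.
  by apply/seteqP; split=> x /=; rewrite in_itv/= andbT => // -[].
exact: mg.
Qed.

Lemma maximal_gt (l : R) x : 0 <= l -> l < Mf x -> exists2 i, Q i x & l < a i.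
Proof.
move=> l0 lM; have M0 := le_lt_trans l0 lM.
have [i _ E] := bigmax0_attained M0.
have Qx : Q i x.
  apply: (@indic_pos (Q i)); rewrite lt_def indic_ge0 andbT.
  by apply: contraTneq M0; rewrite E => ->; rewrite mulr0 ltxx.
by exists i => //; move: lM; rewrite E indic1// mulr1.
Qed.

(** The set is a disjoint union of maximal sets with average above [l]; on each of
    them the part of [f] below [l / 2] accounts for at most half of the
    average. *)
Lemma maximal_weak_type (l : R) : 0 < l ->
  (ws \1_[set x | (l < Mf x)%R] <=
   (2 / l)%:E * ws (fun x => \1_[set x | (l / 2 < f x)%R] x * f x)%R)%E.
Proof.
move=> l0; pose P i := l < a i.
have [M [MP Mdisj Mcov]] := maximal_disjoint nested P.
pose h i x := \1_(Q i) x * (\1_[set x | l / 2 < f x] x * f x).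
have mh0 : measurable_fun setT (fun x => \1_[set x | l / 2 < f x] x * f x).
  by apply: measurable_funM => //; apply: measurable_indic; exact: measurable_level.
have mh i : measurable_fun setT (h i).
  by apply: measurable_funM => //; exact: measurable_indic.
have h0 i x : 0 <= h i x by rewrite !mulr_ge0 ?indic_ge0.
(* [l sQ < fQ] splits into the part of [f] above [l / 2] and at most [l / 2 sQ]. *)
have part i : i \in M -> ((sQ i)%:E <= (2 / l)%:E * ws (h i))%E.
  move=> /MP Pi; have l2 : 0 <= l / 2 by rewrite divr_ge0// ltW.
  have : ((fQ i)%:E <= ws (h i) + (l / 2 * sQ i)%:E)%E.
    have mI : measurable_fun setT (\1_(Q i) : T -> R) by exact: measurable_indic.
    have I0 x : 0 <= (\1_(Q i) x : R) by exact: indic_ge0.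
    have g0 x : 0 <= l / 2 * \1_(Q i) x by rewrite mulr_ge0.
    have mg : measurable_fun setT (fun x => l / 2 * \1_(Q i) x).
      by apply: measurable_funM; first exact: measurable_cst.
    rewrite -fQE EFinM -sQE -(wintegralZ mu ms s0 l2 I0 mI).
    rewrite -(wintegralD mu ms s0 (h0 i) g0 (mh i) mg).
    apply: wintegral_le => // x; last by rewrite addr_ge0// mulr_ge0 ?indic_ge0.
    rewrite /h [X in _ <= _ + X]mulrC -mulrDr ler_wpM2l ?indic_ge0//.
    have [lf|lf] := ltP (l / 2) (f x).
      by rewrite indic1// mul1r lerDl.
    by apply: le_trans lf _; rewrite lerDr mulr_ge0 ?indic_ge0.
  rewrite -leeBlDr// -EFinB => /(le_trans _) H.
  rewrite -[(sQ i)%:E]mul1e -[1%E](_ : (2 / l * (l / 2))%:E = _); last first.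
    by congr EFin; field; rewrite gt_eqF.
  rewrite EFinM -muleA lee_pmul2l ?lte_fin ?divr_gt0//.
  apply: H; rewrite -EFinM lee_fin lerBrDr -mulrDl.
  have -> : l / 2 + l / 2 = l by field.
  by rewrite -ler_pdivlMr// ltW.
apply: (@le_trans _ _ (ws (fun x => \sum_(i in M) 1 * \1_(Q i) x))).
  apply: wintegral_le => // x; last by apply: sumr_ge0 => i _; rewrite mul1r indic_ge0.
  have [lM|lM] := ltP l (Mf x); last first.
    rewrite [leLHS]indicE memNset; last by rewrite /= ltNge lM.
    by apply: sumr_ge0 => i _; rewrite mul1r indic_ge0.
  rewrite indic1//; have [i Qx ai] := maximal_gt (ltW l0) lM.
  have [k kM ik] := Mcov _ ai.
  rewrite (bigD1 k)//= mul1r indic1; last exact: ik.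
  by rewrite lerDl; apply: sumr_ge0 => j _; rewrite mul1r indic_ge0.
rewrite wintegral_sum//; last by move=> i; exact: measurable_indic.
apply: (@le_trans _ _ (\sum_(i in M) (2 / l)%:E * ws (h i)))%E.
  by apply: lee_sum => i iM; rewrite mul1e sQE part.
have l20 : 0 <= 2 / l by rewrite divr_ge0// ltW.
rewrite -(@wintegral_sum _ _ _ mu _ ms s0 _ _ _ (fun=> 2 / l))//.
have hh0 x : 0 <= \1_[set x | l / 2 < f x] x * f x by rewrite mulr_ge0 ?indic_ge0.
rewrite -(wintegralZ mu ms s0 l20 hh0 mh0).
apply: wintegral_le => // x; last by rewrite mulr_ge0.
set y := _ * f x; have y0 : 0 <= y by rewrite mulr_ge0 ?indic_ge0.
rewrite /h -/y; under eq_bigr do rewrite [\1_ _ _ * _]mulrC mulrA.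
have b0 : 0 <= 2 / l * y by rewrite mulr_ge0.
exact: (sum_indic_disjoint b0 b0 Mdisj).
Qed.

(** Decompose the values of the maximal function into levels of ratio [K] and apply
    the weak type bound to each. After summation the factor of [f x] is, up to [D], a sum of
    values of [F t / t] at the halved levels [t] below [f x]; it is geometric
    because [F t / t] doubles when [t] is multiplied by [K], hence comparable to
    [F (f x) / f x]. *)
Lemma maximal_orlicz (F : R -> R) (K D : R) : class_U F -> 1 < K ->
  (forall t, 0 < t -> 2 * (F t / t) <= F (K * t) / (K * t)) ->
  0 < D -> (forall t, 0 < t -> F (2 * K * t) <= D * F t) ->
  (ws (fun x => F (Mf x)) <= (2 * D)%:E * ws (F \o f))%E.
Proof.
move=> UF K1 HK D0 HD; have K0 := lt_trans ltr01 K1.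
have [e [m [e0 He]]] := geometric_range K1 average_ge0.
pose l k := e * K ^+ k; have l0 k : 0 < l k by rewrite mulr_gt0// exprn_gt0.
pose h k x := \1_[set x | l k / 2 < f x] x * f x.
have h0 k x : 0 <= h k x by rewrite mulr_ge0 ?indic_ge0.
have mh k : measurable_fun setT (h k).
  by apply: measurable_funM => //; apply: measurable_indic; exact: measurable_level.
have mL k : measurable [set x | l k < Mf x].
  by apply: measurable_level; exact: measurable_maximal.
have FK0 k : 0 <= F (l k.+1) by rewrite class_U_ge0// ltW.
have F0 x : 0 <= F (f x) by exact: class_U_ge0.
apply: (@le_trans _ _ (ws (fun x =>
    \sum_(k < m) F (l k.+1) * \1_[set x | l k < Mf x] x))).
  have S0 x : 0 <= \sum_(k < m) F (l k.+1) * \1_[set x | l k < Mf x] x.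
    by apply: sumr_ge0 => k _; rewrite mulr_ge0 ?indic_ge0.
  apply: wintegral_le => // x.
  have := bigmax0_ge0 xpredT (fun i => a i * \1_(Q i) x).
  rewrite le_eqVlt => /predU1P[<-|M0]; first by rewrite class_U0.
  have [i Qx _] := maximal_gt (lexx 0) M0.
  have [i' _ E] := bigmax0_attained M0.
  have ai : Mf x = a i'.
    have [j Qj aj] := maximal_gt (lexx 0) M0.
    rewrite E; suff Qi : Q i' x by rewrite indic1// mulr1.
    apply: (@indic_pos (Q i')); rewrite lt_def indic_ge0 andbT.
    by apply: contraTneq M0; rewrite E => ->; rewrite mulr0 ltxx.
  have /andP[ea aK] : e < Mf x <= e * K ^+ m by rewrite ai; apply: He; rewrite -ai.
  have [k km /andP[lM Ml]] := geometric_level ea aK.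
  rewrite (bigD1 (Ordinal km))//= indic1// mulr1.
  apply: (@le_trans _ _ (F (l k.+1))); first by apply: class_U_le => //; exact: ltW.
  by rewrite lerDl; apply: sumr_ge0 => j _; rewrite mulr_ge0 ?indic_ge0.
rewrite wintegral_sum//; last by move=> k; exact: measurable_indic.
apply: (@le_trans _ _ (\sum_(k < m) (F (l k.+1) * (2 / l k))%:E * ws (h k)))%E.
  apply: lee_sum => k _; rewrite EFinM -muleA; apply: lee_wpmul2l; first by rewrite lee_fin.
  exact: maximal_weak_type.
have c0 k : 0 <= F (l k.+1) * (2 / l k) by rewrite mulr_ge0// divr_ge0// ltW.
rewrite -(@wintegral_sum _ _ _ mu _ ms s0 _ _ _ (fun k : 'I_m => F (l k.+1) * (2 / l k)))//.
have mF : measurable_fun setT (F \o f) by exact: measurable_class_U.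
have D20 : 0 <= 2 * D by rewrite mulr_ge0// ltW.
rewrite -(wintegralZ mu ms s0 D20 F0 mF).
apply: wintegral_le => // x; last by rewrite mulr_ge0.
have := f0 x; rewrite le_eqVlt => /predU1P[fx|fx].
  rewrite big1; first by rewrite !mulr_ge0// ltW.
  by move=> k _; rewrite /h -fx !mulr0.
pose phi t := F t / t.
have e2 : 0 < e / 2 by exact: divr_gt0.
(* Levels are halved because [maximal_weak_type] involves [f] above [l k / 2]. *)
have geo := @geometric_sum_le _ phi K (e / 2) (f x) m e2 K0.
have {}geo : \sum_(k < m) phi (e / 2 * K ^+ k) * (e / 2 * K ^+ k < f x)%R%:R
    <= 2 * phi (f x).
  apply: geo => //.
  - by move=> t t0; rewrite divr_ge0 ?class_U_ge0 ?ltW.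
  - by move=> u t u0 ut; exact: class_U_ratio.
apply: (@le_trans _ _ (D * f x * (2 * phi (f x)))); last first.
  have -> : D * f x * (2 * phi (f x)) = 2 * D * F (f x).
    by rewrite /phi; field; rewrite gt_eqF.
  by [].
have Df0 : 0 <= D * f x by rewrite mulr_ge0// ltW.
apply: le_trans (ler_wpM2l Df0 geo).
rewrite mulr_sumr; apply: ler_sum => k _.
have E : e / 2 * K ^+ k = l k / 2 by rewrite /l mulrAC.
rewrite E /h; have [lf|lf] := ltP (l k / 2) (f x); last first.
  by rewrite indicE memNset ?mul0r ?mulr0// /= ltNge lf.
rewrite indic1// mul1r mulr1 /phi.
have -> : l k.+1 = 2 * K * (l k / 2) by rewrite /l exprS; field.
have l2 : 0 < l k / 2 by exact: divr_gt0.
have := HD (l k / 2) l2.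
set X := F (2 * K * _); set Y := F (l k / 2) => XY.
have -> : X * (2 / l k) * f x = X * (2 / l k * f x) by rewrite -[LHS]mulrA.
have -> : D * f x * (Y / (l k / 2)) = (D * Y) * (2 / l k * f x).
  by field; rewrite gt_eqF.
have w0 : 0 <= 2 / l k * f x by rewrite mulr_ge0 ?divr_ge0// ltW.
by rewrite ler_wpM2r.
Qed.

End orlicz_maximal.

(** * The Carleson embedding *)

Section carleson_embedding.
Context d (T : measurableType d) {R : realType}.
Local Notation Rplus := (`[0, +oo[%classic : set R).
Variable mu : {measure set T -> \bar R}.
Variables s w : T -> R.
Hypotheses (ms : measurable_fun setT s) (s0 : forall x, 0 <= s x).
Hypotheses (mw : measurable_fun setT w) (w0 : forall x, 0 <= w x).
Local Notation ws := (wintegral mu s).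
Local Notation ww := (wintegral mu w).
Variables (I : finType) (Q : I -> set T) (sQ : I -> R).
Hypothesis mQ : forall i, measurable (Q i).
Hypothesis nested : forall i k x, Q i x -> Q k x -> Q i `<=` Q k \/ Q k `<=` Q i.
Hypotheses (sQ0 : forall i, 0 < sQ i) (sQE : forall i, ws \1_(Q i) = (sQ i)%:E).

Variables (n : nat) (Phis : 'I_n -> R -> R) (Phi Psi : R -> R).
Hypotheses (n_gt0 : (0 < n)%N) (Phis_U : forall i, class_U (Phis i)).
Hypothesis Phi_bij : set_bij Rplus Rplus Phi.
Hypothesis Phi_inv : forall t, 0 <= t ->
  inv_growth Phi t = \prod_(i < n) inv_growth (Phis i) t.
Hypothesis PsiPhi : forall s t, 0 < s -> s <= t -> Psi s / Phi s <= Psi t / Phi t.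
Variables (q c : R).
Hypotheses (q1 : 1 <= q) (c0 : 0 < c).
Hypothesis Psi_q : forall t, 0 <= t -> t `^ q <= c * Psi t /\ Psi t <= c * t `^ q.
Variables K D : 'I_n -> R.
Hypothesis K1 : forall j, 1 < K j.
Hypothesis HK : forall j t, 0 < t ->
  2 * (Phis j t / t) <= Phis j (K j * t) / (K j * t).
Hypothesis D0 : forall j, 0 < D j.
Hypothesis HD : forall j t, 0 < t -> Phis j (2 * K j * t) <= D j * Phis j t.

Variable f : 'I_n -> T -> R.
Hypotheses (f0 : forall j x, 0 <= f j x) (mf : forall j, measurable_fun setT (f j)).
Hypothesis f1 : forall j, (ws (Phis j \o f j) <= 1)%E.
Variable fQ : 'I_n -> I -> R.
Hypothesis fQE : forall j i, ws (fun x => \1_(Q i) x * f j x) = (fQ j i)%:E.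
Local Notation a j i := (fQ j i / sQ i).
Local Notation g i := (\prod_(j < n) a j i).
Local Notation A := (2 ^+ n : R).
Local Notation v i := (inv_growth Phi (sQ i)^-1).

(** The bounds of [average_le] multiply because [Phi^-1] is the product of the
    inverse functions. *)
Lemma product_average_le i : g i <= A * v i.
Proof.
have u0 : 0 < (sQ i)^-1 by rewrite invr_gt0.
rewrite (Phi_inv (ltW u0)).
have -> : A = \prod_(j < n) 2 by rewrite prodr_const card_ord.
rewrite -big_split /=; apply: ler_prod => j _; apply/andP; split.
  exact: (average_ge0 s0 sQ0 (f0 j) (fQE j)).
rewrite ler_pdivrMr// -lee_fin -fQE.
exact: (average_le ms s0 mQ sQ0 sQE).
Qed.

Lemma product_average_ge0 i : 0 <= g i.
Proof.
by apply: prodr_ge0 => j _; exact: (average_ge0 s0 sQ0 (f0 j) (fQE j)).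
Qed.

Local Notation Mf j x := (\big[Num.max/0]_i (a j i * \1_(Q i) x)).
Local Notation Gf x := (\prod_(j < n) Mf j x).

Lemma product_maximal_ge i x : Q i x -> g i <= Gf x.
Proof.
move=> Qx; apply: ler_prod => j _; rewrite (average_ge0 s0 sQ0 (f0 j) (fQE j)) /=.
by have := @le_bigmax0 R I xpredT (fun i => a j i * \1_(Q i) x) i isT;
  rewrite indic1// mulr1.
Qed.

Lemma product_maximal_orlicz : (ws (fun x => Phi (Gf x)) <= (\sum_(j < n) 2 * D j)%:E)%E.
Proof.
have M0 j x : 0 <= Mf j x by exact: bigmax0_ge0.
have mM j : measurable_fun setT (fun x => Mf j x) by exact: measurable_maximal.
have P0 j x : 0 <= Phis j (Mf j x) by exact: class_U_ge0.
have mP j : measurable_fun setT (fun x => Phis j (Mf j x)).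
  exact: (measurable_class_U (Phis_U j) (M0 j)).
apply: (@le_trans _ _ (ws (fun x => \sum_(j < n) 1 * Phis j (Mf j x)))).
  apply: wintegral_le => // x; last by apply: sumr_ge0 => j _; rewrite mul1r.
  apply: le_trans (product_growth_prod Phis_U Phi_bij Phi_inv _) _ => //.
  by apply: ler_sum => j _; rewrite mul1r.
rewrite (wintegral_sum mu ms s0 _ _ (fun _ => ler01) P0 mP) -sumEFin.
apply: lee_sum => j _; rewrite mul1e.
apply: le_trans (maximal_orlicz ms s0 mQ nested sQ0 sQE (f0 j) (mf j) (fQE j)
  (Phis_U j) (K1 j) (HK j) (D0 j) (HD j)) _.
rewrite -[leRHS]mule1; apply: lee_wpmul2l => //.
by rewrite lee_fin mulr_ge0// ltW.
Qed.

Variables (b : I -> R) (S : R).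
Hypotheses (b0 : forall i, 0 <= b i) (S0 : 0 <= S).
Local Notation Tf r x :=
  (\big[Num.max/0]_(i | `[< Q i `<=` Q r >]) (b i * \1_(Q i) x)).
Hypothesis testing : forall r,
  (ww (fun x => (Tf r x) `^ q)%R <= (S / (v r) `^ q)%:E)%E.

(** In the constant, one factor [A^q] rounds the averages up to the next level,
    [c^2 A^q] comes from [power_product_le], [2] from the geometric sum over the
    levels, and the sum of the [2 * D j] from [product_maximal_orlicz]. *)
Lemma carleson_embedding :
  (ww (fun x => (\big[Num.max/0]_i (b i * g i * \1_(Q i) x)) `^ q)%R <=
   (A `^ q * (c ^+ 2 * A `^ q) * (2 * \sum_(j < n) 2 * D j) * S)%:E)%E.
Proof.
have A1 : 1 < A by rewrite exprn_egt1 ?ltr1n// -lt0n.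
have A0 : 0 < A := lt_trans ltr01 A1.
have q0 : q != 0 by rewrite gt_eqF// (lt_le_trans ltr01).
have q00 : 0 <= q by rewrite (le_trans ler01).
have [e [m [e0 He]]] := geometric_range A1 product_average_ge0.
pose l k := e * A ^+ k; have l0 k : 0 < l k by rewrite mulr_gt0// exprn_gt0.
have /choice[M HM] (k : nat) := maximal_disjoint nested (fun i => l k < g i).
have mT r : measurable_fun setT (fun x => (Tf r x) `^ q).
  apply: (measurableT_comp (measurable_powR _)) => //.
  apply: measurable_bigmax => i.
  by apply: measurable_funM; [exact: measurable_cst|exact: measurable_indic].
pose rhs x := \sum_(k < m) \sum_(r in M k) (l k.+1) `^ q * (Tf r x) `^ q.
have v0 i : 0 < v i.
  by apply: (inv_product_gt0 Phis_U Phi_inv); rewrite invr_gt0.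
have Phi_v i : Phi (v i) = (sQ i)^-1.
  by rewrite (inv_growthK Phi_bij)// invr_ge0 ltW.
have Pl0 k : 0 < Phi (l k) by exact: (product_growth_gt0 n_gt0 Phis_U Phi_bij Phi_inv).
(* A positive maximum at [x] is attained by a cube of some level [k], which lies
   in a maximal cube [r] of that level; so it is at most [l k.+1] times [Tf r x]. *)
apply: (@le_trans _ _ (ww rhs)).
  have rhs_ge0 x : 0 <= rhs x.
    by apply: sumr_ge0 => k _; apply: sumr_ge0 => r _; rewrite mulr_ge0 ?powR_ge0.
  apply: wintegral_le => // x.
  have := bigmax0_ge0 xpredT (fun i => b i * g i * \1_(Q i) x).
  rewrite le_eqVlt => /predU1P[<-|V0]; first by rewrite powR0.
  have [i _ E] := bigmax0_attained V0; rewrite E in V0 *.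
  have Qx : Q i x.
    apply: (@indic_pos _ _ R (Q i)); rewrite lt_def indic_ge0 andbT.
    by apply: contraTneq V0 => ->; rewrite mulr0 ltxx.
  rewrite indic1// mulr1 in V0 *.
  have gi0 : 0 < g i.
    rewrite lt_def product_average_ge0 andbT.
    by apply: contraTneq V0 => ->; rewrite mulr0 ltxx.
  have /andP[eg gA] := He _ gi0.
  have [k km /andP[lg gl]] := geometric_level eg gA.
  have [MP Mdisj Mcov] := HM k; have [r rM ir] := Mcov _ lg.
  have main : (b i * g i) `^ q <= (l k.+1) `^ q * (Tf r x) `^ q.
    rewrite -powRM ?bigmax0_ge0 ?(ltW (l0 _))//.
    have T0 : 0 <= Tf r x by exact: bigmax0_ge0.
    have bg0 : 0 <= b i * g i by rewrite mulr_ge0 ?product_average_ge0.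
    have lT0 : 0 <= l k.+1 * Tf r x by rewrite mulr_ge0 ?(ltW (l0 _)).
    apply: ge0_ler_powR; rewrite ?nnegrE//.
    rewrite mulrC ler_pM ?product_average_ge0//.
    have := @le_bigmax0 R I (fun i => `[< Q i `<=` Q r >]) (fun i => b i * \1_(Q i) x) i.
    by rewrite indic1// mulr1; apply; exact/asboolP.
  apply: (le_trans main); pose h (k : nat) r := (l k.+1) `^ q * (Tf r x) `^ q.
  have h0 j r' : 0 <= h j r' by rewrite mulr_ge0 ?powR_ge0.
  apply: (@le_trans _ _ (\sum_(r in M k) h k r)).
    by rewrite -/(h k r) (bigD1 r)//= lerDl sumr_ge0.
  rewrite /rhs (bigD1 (Ordinal km))//= lerDl.
  by apply: sumr_ge0 => j _; apply: sumr_ge0 => r' _; exact: h0.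
have -> : ww rhs = (\sum_(k < m)
    \sum_(r in M k) (((l k.+1) `^ q)%:E * ww (fun x => (Tf r x) `^ q)%R))%E.
  have -> : rhs = (fun x => \sum_(k < m) 1 * \sum_(r in M k) (l k.+1) `^ q * (Tf r x) `^ q).
    by apply/funext => x; apply: eq_bigr => k _; rewrite mul1r.
  have lq0 (k : 'I_m) (r : I) : 0 <= (l k.+1) `^ q by exact: powR_ge0.
  have Tq0 r x : 0 <= (Tf r x) `^ q by exact: powR_ge0.
  have m2 (k : 'I_m) : measurable_fun setT
      (fun x => \sum_(r in M k) (l k.+1) `^ q * (Tf r x) `^ q).
    apply: measurable_bigsum => r.
    by apply: measurable_funM; [exact: measurable_cst|exact: mT].
  have p2 (k : 'I_m) x : 0 <= \sum_(r in M k) (l k.+1) `^ q * (Tf r x) `^ q.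
    by apply: sumr_ge0 => r _; rewrite mulr_ge0 ?powR_ge0.
  rewrite (wintegral_sum mu mw w0 _ _ (fun _ => ler01) p2 m2).
  by apply: eq_bigr => k _; rewrite mul1e (wintegral_sum mu mw w0 _ _ (lq0 k) Tq0 mT).
set C1 := A `^ q * (c ^+ 2 * A `^ q); have C10 : 0 <= C1.
  by rewrite !mulr_ge0 ?powR_ge0 ?exprn_ge0 ?(ltW c0).
(* The testing bound [S / (v r) ^ q] is turned into a multiple of the mass [sQ r],
   which is additive over the disjoint cubes of a level. *)
have term (k : nat) r : r \in M k ->
    (((l k.+1) `^ q)%:E * ww (fun x => (Tf r x) `^ q)%R <=
     (C1 * S * (Phi (l k) * sQ r))%:E)%E.
  move=> rM; have [MP _ _] := HM k; have lg := MP _ rM.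
  have lv : l k <= A * v r by apply: le_trans (ltW lg) (product_average_le r).
  have := power_product_le n_gt0 Phis_U Phi_bij Phi_inv PsiPhi c0 Psi_q (l0 k) (v0 r) lv.
  rewrite Phi_v => H.
  apply: (@le_trans _ _ (((l k.+1) `^ q)%:E * (S / v r `^ q)%:E)%E).
    by apply: lee_wpmul2l => //; rewrite lee_fin powR_ge0.
  rewrite -EFinM lee_fin.
  have -> : l k.+1 = A * l k by rewrite /l exprS mulrCA.
  rewrite powRM ?(ltW (l0 k)) ?(ltW A0)//.
  have vq0 : 0 < v r `^ q by exact: powR_gt0.
  rewrite [leLHS]mulrA ler_pdivrMr//.
  rewrite ler_pdivrMr// in H.
  rewrite /C1; set X := A `^ q in H *; set Y := l k `^ q in H *.
  have -> : X * Y * S = (X * S) * Y by ring.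
  set Z := v r `^ q in H *.
  have -> : X * (c ^+ 2 * X) * S * (Phi (l k) * sQ r) * Z =
    (X * S) * (c ^+ 2 * X * (Z * Phi (l k)) * sQ r) by ring.
  by apply: ler_wpM2l => //; rewrite mulr_ge0// powR_ge0.
apply: (@le_trans _ _ (\sum_(k < m) \sum_(r in M k)
    (C1 * S)%:E * (Phi (l k) * sQ r)%:E))%E.
  by apply: lee_sum => k _; apply: lee_sum => r rM; rewrite -EFinM term.
have CS0 : 0 <= C1 * S by exact: mulr_ge0.
have P0 (k : nat) r : 0 <= Phi (l k) * sQ r by rewrite mulr_ge0// ltW.
have packing : (\sum_(k < m) \sum_(r in M k) (Phi (l k) * sQ r)%:E <=
    (2 * \sum_(j < n) 2 * D j)%:E)%E.
  have -> : (\sum_(k < m) \sum_(r in M k) (Phi (l k) * sQ r)%:E)%E =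
      ws (fun x => \sum_(k < m) 1 * \sum_(r in M k) Phi (l k) * \1_(Q r) x).
    have Pk0 (k : 'I_m) (r : I) : 0 <= Phi (l k) by exact: ltW.
    have mI (r : I) : measurable_fun setT (\1_(Q r) : T -> R) by exact: measurable_indic.
    have I0 (r : I) x : 0 <= (\1_(Q r) x : R) by exact: indic_ge0.
    have m2 (k : 'I_m) : measurable_fun setT
        (fun x => \sum_(r in M k) Phi (l k) * \1_(Q r) x).
      apply: measurable_bigsum => r.
      by apply: measurable_funM; [exact: measurable_cst|exact: mI].
    have p2 (k : 'I_m) x : 0 <= \sum_(r in M k) Phi (l k) * \1_(Q r) x.
      by apply: sumr_ge0 => r _; rewrite mulr_ge0// ltW.
    rewrite (wintegral_sum mu ms s0 _ _ (fun _ => ler01) p2 m2).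
    apply: eq_bigr => k _; rewrite mul1e (wintegral_sum mu ms s0 _ _ (Pk0 k) I0 mI).
    by apply: eq_bigr => r _; rewrite sQE.
  have M0 j x : 0 <= Mf j x by exact: bigmax0_ge0.
  have G0 x : 0 <= Gf x by apply: prodr_ge0.
  have PG0 x : 0 <= Phi (Gf x) by exact: (growth_ge0 Phi_bij).
  apply: (@le_trans _ _ (2%:E * ws (fun x => Phi (Gf x)))%E); last first.
    by rewrite EFinM; apply: lee_wpmul2l => //; exact: product_maximal_orlicz.
  apply: le_trans (ge0_integralZl_le mu (ltr0n _ 2) _); last first.
    by move=> x _; rewrite lee_fin mulr_ge0.
  rewrite /wintegral; under [leRHS]eq_integral do rewrite -EFinM mulrA.
  apply: (@wintegral_le _ _ _ mu s s0) => x; last by rewrite mulr_ge0.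
  apply: (@le_trans _ _ (\sum_(k < m) Phi (l k) * (l k < Gf x)%R%:R)).
    apply: ler_sum => k _; rewrite mul1r; have [MP Mdisj _] := HM k.
    apply: (sum_indic_disjoint (ltW (Pl0 k))) => //.
      by rewrite mulr_ge0// ltW.
    move=> r rM Qx; rewrite (lt_le_trans (MP _ rM) (product_maximal_ge Qx)).
    by rewrite mulr1.
  have := G0 x; rewrite le_eqVlt => /predU1P[<-|Gx0].
    rewrite big1 ?mulr_ge0 ?(growth_ge0 Phi_bij)// => k _.
    by rewrite ltNge (ltW (l0 k)) mulr0.
  apply: geometric_sum_le => //.
  - by move=> t t0; apply: (growth_ge0 Phi_bij); exact: ltW.
  - by move=> t u t0 tu; apply: (product_growth_le Phis_U Phi_bij Phi_inv) => //; exact: ltW.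
  - by move=> t t0; apply: (product_growth_double Phis_U Phi_bij Phi_inv); exact: ltW.
rewrite [X in (_ <= X%:E)%E](_ : _ = C1 * S * (2 * \sum_(j < n) 2 * D j)); last by ring.
rewrite [X in (_ <= X)%E]EFinM.
have CS0' : (0 <= (C1 * S)%:E)%E by rewrite lee_fin.
apply: le_trans (lee_wpmul2l CS0' packing).
rewrite ge0_sume_distrr; last by move=> k _; apply: sume_ge0 => r _; rewrite lee_fin.
apply: lee_sum => k _; rewrite ge0_sume_distrr//.
by move=> r _; rewrite lee_fin.
Qed.

End carleson_embedding.

(** * The fractional maximal function *)

Section extended_reals.
Context {R : realType}.
Local Open Scope ereal_scope.

Lemma lee_prod (I : Type) (r : seq I) (P : pred I) (x y : I -> \bar R) :
  (forall i, P i -> 0 <= x i) -> (forall i, P i -> x i <= y i) ->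
  \prod_(i <- r | P i) x i <= \prod_(i <- r | P i) y i.
Proof.
move=> x0 xy.
suff : 0 <= \prod_(i <- r | P i) x i /\
    \prod_(i <- r | P i) x i <= \prod_(i <- r | P i) y i by case.
apply: (big_ind2 (fun a b => 0 <= a /\ a <= b)) => [|a b a' b' [a0 ab] [a'0 ab']|i Pi].
- by split.
- by split; [exact: mule_ge0|exact: lee_pmul].
- by split; [exact: x0|exact: xy].
Qed.

Lemma er_map_ge0 (F : R -> R) x : (forall t, (0 <= t)%R -> (0 <= F t)%R) ->
  0 <= x -> 0 <= er_map F x.
Proof. by move=> F0; case: x => [r| |] //=; rewrite !lee_fin; exact: F0. Qed.

Lemma er_map_le (F : R -> R) x y :
  (forall s t, (0 <= s)%R -> (s <= t)%R -> (F s <= F t)%R) ->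
  0 <= x -> x <= y -> er_map F x <= er_map F y.
Proof.
move=> Fle; case: x => [r| |] //; case: y => [t| |] //=.
  by rewrite !lee_fin; exact: Fle.
by rewrite !leey.
Qed.

Lemma normc_real (x : R) : ComplexField.Normc.normc (x%:C)%C = `|x|%R.
Proof. by rewrite /= expr0n addr0 sqrtr_sqr. Qed.

Lemma normc_ge0 (x : R[i]) : (0 <= ComplexField.Normc.normc x)%R.
Proof. by case: x => a b; exact: sqrtr_ge0. Qed.

End extended_reals.

Section fracmax_facts.
Context {R : realType} (n d : nat) (alpha : R).
Local Notation leb := (lebesgue_rV R d).
Local Notation T := (lebesgue_type R d).
Local Open Scope ereal_scope.
Local Notation normc := ComplexField.Normc.normc.

Lemma measurable_normc (f : 'rV[R]_d -> R[i]) : cmeasurable f ->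
  measurable_fun [set: T] (fun x => normc (f x)).
Proof.
move=> [mr mi].
have -> : (fun x => normc (f x)) = (fun x : T =>
    (complex.Re (f x) ^+ 2 + complex.Im (f x) ^+ 2) `^ 2^-1)%R.
  apply/funext => x; case: (f x) => a b /=; rewrite powR12_sqrt//.
  by rewrite addr_ge0 ?sqr_ge0.
apply: (measurableT_comp (measurable_powR _)) => //.
by apply: measurable_funD; exact: measurable_funX.
Qed.

Lemma fracmax_ge0 (f : 'I_n -> 'rV[R]_d -> R[i]) x : 0 <= fracmax alpha f x.
Proof.
pose Q : set 'rV[R]_d := cube 0%R 1%R.
apply: le_ereal_sup_tmp; exists (((fine (leb Q)) `^ (alpha / d%:R))%:E *
    \prod_(i < n) ((\1_Q x / fine (leb Q))%:E * \int[leb]_(y in Q) cabs (f i) y)).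
  by exists Q => //; exists 0%R, 1%R.
apply: mule_ge0; first by rewrite lee_fin powR_ge0.
apply: prode_ge0 => i _; apply: mule_ge0.
  by rewrite lee_fin divr_ge0// ?indic_ge0// fine_ge0// measure_ge0.
by apply: integral_ge0 => y _; rewrite lee_fin normc_ge0.
Qed.

Lemma fracmax_ge_cube (f : 'I_n -> 'rV[R]_d -> R[i]) (a : 'rV[R]_d) (l : R) x :
  (0 < l)%R -> cube a l x ->
  ((l ^+ d) `^ (alpha / d%:R))%:E *
    \prod_(i < n) (((l ^+ d)^-1)%:E * \int[leb]_(y in cube a l) cabs (f i) y) <=
  fracmax alpha f x.
Proof.
move=> l0 Qx; apply: ereal_sup_ubound; exists (cube a l).
  by exists a, l.
rewrite (lebesgue_cube a l0) /=; congr (_ * _).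
by apply: eq_bigr => i _; rewrite indicE mem_set// div1r.
Qed.

(** A cube that does not contain [x] contributes zero, because [n] is positive. *)
Lemma fracmax_gt (f : 'I_n -> 'rV[R]_d -> R[i]) (y : R) x :
  (0 <= y)%R -> y%:E < fracmax alpha f x ->
  (0 < n)%N -> exists a l, [/\ (0 < l)%R, cube a l x &
  y%:E < ((l ^+ d) `^ (alpha / d%:R))%:E *
    \prod_(i < n) (((l ^+ d)^-1)%:E * \int[leb]_(y in cube a l) cabs (f i) y)].
Proof.
move=> y0 + n0 => /ereal_sup_gt[_ [_ [a [l [l0 ->]]] <-]] yQ.
exists a, l; split=> //.
  apply: contrapT => nQ; move: yQ; apply/negP; rewrite -leNgt.
  rewrite [X in _ * X](_ : _ = 0) ?mule0 ?lee_fin//.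
  by rewrite (bigD1 (Ordinal n0))//= indicE memNset// mul0r !mul0e.
apply: lt_le_trans yQ _; rewrite (lebesgue_cube a l0) /=.
apply: lee_wpmul2l; first by rewrite lee_fin powR_ge0.
have I0 i : 0 <= \int[leb]_(z in cube a l) cabs (f i) z.
  by apply: integral_ge0 => z _; rewrite lee_fin normc_ge0.
have ld0 : (0 <= (l ^+ d)^-1)%R by rewrite invr_ge0 exprn_ge0// ltW.
apply: lee_prod => i _.
  by apply: mule_ge0 => //; rewrite lee_fin mulr_ge0// indic_ge0.
apply: lee_wpmul2r => //; rewrite lee_fin ler_piMl//.
Qed.

End fracmax_facts.

(** * Testing on dyadic cubes *)

Section sawyer_testing.
Context {R : realType} (n d : nat) (alpha : R).
Local Notation Rplus := (`[0, +oo[%classic : set R).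
Variables (Phis : 'I_n -> R -> R) (Phi Psi : R -> R).
Hypothesis Phis_U : forall i, class_U (Phis i).
Hypothesis Phi_bij : set_bij Rplus Rplus Phi.
Hypothesis Phi_inv : forall t, 0 <= t ->
  inv_growth Phi t = \prod_(i < n) inv_growth (Phis i) t.
Hypothesis Psi_U : class_U Psi.
Variables (q c : R).
Hypotheses (q1 : 1 <= q) (c0 : 0 < c).
Hypothesis Psi_q : forall t, 0 <= t -> t `^ q <= c * Psi t /\ Psi t <= c * t `^ q.
Local Notation leb := (lebesgue_rV R d).
Local Notation T := (lebesgue_type R d).
Variables omega sigma : 'rV[R]_d -> R.
Hypotheses (w_omega : weight omega) (w_sigma : weight sigma).
Local Notation s := (fun x : T => `|sigma x|).
Local Notation w := (fun x : T => `|omega x|).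
Local Open Scope ereal_scope.
Local Notation ws := (wintegral leb s).
Local Notation ww := (wintegral leb w).

Let ms : measurable_fun setT s := measurable_abs_weight w_sigma.
Let mw : measurable_fun setT w := measurable_abs_weight w_omega.
Let s0 x : (0 <= s x)%R. Proof. exact: normr_ge0. Qed.
Let w0 x : (0 <= w x)%R. Proof. exact: normr_ge0. Qed.

(** [nu] equals [sigma] wherever [sigma] is positive. *)
Lemma nu_mass (E : set T) :
  weight_measure (nu Phis Phi sigma) E = \int[leb]_(x in E) (s x)%:E.
Proof.
have E1 : {ae leb, forall x, s x = nu Phis Phi sigma x}.
  apply: ae_imply2 (abs_weight_gt0 w_sigma) (abs_weightE w_sigma) => x sx0 sx.
  rewrite sx in sx0 *; rewrite /nu -Phi_inv ?divr_ge0// ?ltW//.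
  by rewrite (inv_growthK Phi_bij) ?divr_ge0 ?ltW// !div1r invrK.
apply/eqP; rewrite eq_le; apply/andP; split; apply: ae_le_integral.
- by apply: ae_imply E1 => x -> _.
- by apply: aeW => x _; rewrite lee_fin.
- by apply: ae_imply E1 => x <- _.
- by apply: ae_imply E1 => x <- _; rewrite lee_fin normr_ge0.
Qed.

Lemma sawyer_term_le (S0 : R) (a : 'rV[R]_d) (l m : R) : (0 < l)%R ->
  \int[leb]_(x in cube a l) (s x)%:E = m%:E ->
  sawyer_const alpha Phis Phi Psi sigma omega <= S0%:E ->
  (Psi (inv_growth Phi m^-1))%:E *
    \int[leb]_(x in cube a l) (er_map Psi (fracmax alpha
        (fun (_ : 'I_n) y => (sigma y * \1_(cube a l) y)%:C%C) x) * (omega x)%:E)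
  <= S0%:E.
Proof.
move=> l0 mE; apply: le_trans; apply: ereal_sup_ubound; exists (cube a l).
  by exists a, l.
by rewrite nu_mass mE /= div1r.
Qed.

Lemma mass_grid t i : exists2 m : R, (0 < m)%R & ws \1_(@grid R d t i) = m%:E.
Proof.
have mG : measurable (@grid R d t i) by exact: measurable_half_open_cube.
rewrite wintegral_indic//.
have fin := @weight_half_open_fin R d _ w_sigma (grid_corner t i) (grid_side d i).
have pos := weight_half_open_gt0 w_sigma (grid_corner t i) (@grid_side_gt0 R d i).
exists (fine (\int[leb]_(x in grid t i) (s x)%:E)).
  by rewrite fine_gt0// pos.
by rewrite fineK// ge0_fin_numE// ltW.
Qed.

(** The hypothesis on the Sawyer constant concerns closed cubes and the full
    maximal operator; it implies the testing condition for a finite family of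
    half-open cubes inside [grid t r], since the maximal function of the family
    is smaller, and the closure of [grid t r] has the same mass. *)
Lemma testing_grid (S0 : R) t (N : nat) (sQ : 'I_N -> R) (r : 'I_N) :
  (0 <= S0)%R ->
  (forall i : 'I_N, ws \1_(@grid R d t i) = (sQ i)%:E) -> (forall i, (0 < sQ i)%R) ->
  sawyer_const alpha Phis Phi Psi sigma omega <= S0%:E ->
  ww (fun x => (\big[Num.max/0]_(i < N | `[< @grid R d t i `<=` @grid R d t r >])
     (((grid_side d i : R) ^+ d) `^ (alpha / d%:R) * (sQ i / (grid_side d i) ^+ d) ^+ n
       * \1_(grid t i) x)) `^ q)%R
  <= (c ^+ 2 * S0 / (inv_growth Phi (sQ r)^-1) `^ q)%:E.
Proof.
move=> S00 sQE sQ0 HS; set v := inv_growth Phi _.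
pose b (i : 'I_N) := (((grid_side d i : R) ^+ d) `^ (alpha / d%:R) *
  (sQ i / (grid_side d i) ^+ d) ^+ n)%R.
pose P (i : 'I_N) := `[< @grid R d t i `<=` @grid R d t r >].
pose Tf (x : T) : R := (\big[Num.max/0]_(i < N | P i) (b i * \1_(grid t i) x))%R.
rewrite -[X in ww X]/(fun x => Tf x `^ q)%R.
have v0 : (0 < v)%R by apply: (inv_product_gt0 Phis_U Phi_inv); rewrite invr_gt0.
have Psiv : (0 < Psi v)%R by exact: class_U_gt0.
pose Q : set 'rV[R]_d := cube (grid_corner t r) (grid_side d r).
have L0 i : (0 < grid_side d i :> R)%R by exact: grid_side_gt0.
have q0 : q != 0%R by rewrite gt_eqF// (lt_le_trans ltr01).
have mG i : measurable (@grid R d t i) by exact: measurable_half_open_cube.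
pose F (x : T) := fracmax alpha (fun (_ : 'I_n) y => (sigma y * \1_Q y)%:C%C) x.
have F0 x : 0 <= F x by exact: fracmax_ge0.
have P0 u : (0 <= u)%R -> (0 <= Psi u)%R by exact: class_U_ge0.
have H := sawyer_term_le (L0 r) _ HS.
have {H} : (Psi v)%:E * \int[leb]_(x in Q) (er_map Psi (F x) * (omega x)%:E) <= S0%:E.
  apply: H; rewrite -sQE wintegral_indic//; apply: integral_cube_half_open => //.
  exact/measurable_EFinP.
rewrite -lee_pdivlMl// => HQ.
have Tf_F x : (Tf x)%:E <= F x.
  have := bigmax0_ge0 P (fun i : 'I_N => b i * \1_(grid t i) x)%R.
  rewrite -/(Tf x) le_eqVlt => /predU1P[<-//|T0].
  have [i /asboolP ir E] := bigmax0_attained T0; rewrite -/(Tf x) in E.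
  have ix : grid t i x.
    apply: (@indic_pos _ T R); rewrite lt_def indic_ge0 andbT.
    by apply: contraTneq T0; rewrite E => ->; rewrite mulr0 ltxx.
  rewrite E indic1// mulr1.
  apply: le_trans (fracmax_ge_cube _ _ (L0 i) (half_open_cube_sub ix)).
  rewrite EFinM; apply: lee_wpmul2l; first by rewrite lee_fin powR_ge0.
  have -> : ((sQ i / grid_side d i ^+ d) ^+ n)%R =
      (\prod_(j < n) (sQ i / grid_side d i ^+ d))%R.
    by rewrite prodr_const card_ord.
  rewrite -prodEFin; apply: lee_prod => j _.
    by rewrite lee_fin divr_ge0 ?exprn_ge0// ltW.
  rewrite mulrC EFinM; apply: lee_wpmul2l.
    by rewrite lee_fin invr_ge0 exprn_ge0// ltW.
  rewrite -sQE wintegral_indic// integral_mkcond [leRHS]integral_mkcond.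
  apply: le_integral_pointwise => y _; rewrite /patch.
    case: ifPn => [/set_mem iy|_]; last first.
      by case: ifP => // _; rewrite lee_fin normc_ge0.
    rewrite mem_set; last exact: half_open_cube_sub.
    rewrite /cabs normc_real lee_fin normrM indicE mem_set ?normr1 ?mulr1//.
    by apply: half_open_cube_sub; apply: ir.
  by case: ifP => // _; rewrite lee_fin normc_ge0.
have Tf_out x : ~ Q x -> Tf x = 0%R.
  move=> nQx; apply/eqP; rewrite eq_le bigmax0_ge0 andbT leNgt; apply/negP => T0.
  have [i /asboolP ir E] := bigmax0_attained T0; rewrite -/(Tf x) in E.
  apply: nQx; apply: half_open_cube_sub; apply: ir.
  apply: (@indic_pos _ T R); rewrite lt_def indic_ge0 andbT.
  by apply: contraTneq T0; rewrite E => ->; rewrite mulr0 ltxx.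
have G0 x : 0 <= er_map Psi (F x) * (w x)%:E.
  by apply: mule_ge0; [exact: er_map_ge0|rewrite lee_fin].
have Tf0 x : (0 <= Tf x)%R by exact: bigmax0_ge0.
apply: (@le_trans _ _ (\int[leb]_(x in Q) (c%:E * (er_map Psi (F x) * (w x)%:E)))).
  rewrite /wintegral [leRHS]integral_mkcond; apply: le_integral_pointwise => x _; rewrite patchE.
    case: ifPn => [/set_mem Qx|]; last first.
      by rewrite notin_setE => nQx; rewrite Tf_out// powR0// mul0r.
    rewrite muleA EFinM; apply: lee_wpmul2r; first by rewrite lee_fin.
    have [h _] := Psi_q (Tf0 x).
    apply: (@le_trans _ _ (c * Psi (Tf x))%:E); first by rewrite lee_fin.
    rewrite EFinM; apply: lee_wpmul2l; first by rewrite lee_fin ltW.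
    by apply: (er_map_le (class_U_le Psi_U) (x := (Tf x)%:E)); rewrite ?lee_fin.
  by case: ifPn => // _; apply: mule_ge0 => //; rewrite lee_fin ltW.
apply: le_trans (ge0_integralZl_le leb c0 _) _ => //.
have -> : (c ^+ 2 * S0 / v `^ q)%R = (c * (c * S0 / v `^ q))%R by rewrite expr2 -!mulrA.
rewrite EFinM; apply: lee_wpmul2l; first by rewrite lee_fin ltW.
apply: (@le_trans _ _ (\int[leb]_(x in Q) (er_map Psi (F x) * (omega x)%:E))).
  apply: ae_le_integral; first by apply: ae_imply (abs_weightE w_omega) => x ->.
  by apply: ae_imply (abs_weightE w_omega) => x E _; rewrite -E.
apply: (le_trans HQ); rewrite -EFinM lee_fin.
have [h _] := Psi_q (ltW v0); have vq0 : (0 < v `^ q)%R by exact: powR_gt0.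
rewrite mulrC ler_pdivlMr// mulrAC ler_pdivrMr//.
by rewrite mulrC [leRHS]mulrAC ler_wpM2r.
Qed.

End sawyer_testing.

(** * From the testing condition to a modular inequality *)

Section sufficiency.
Context {R : realType} (n d : nat) (alpha : R).
Local Notation Rplus := (`[0, +oo[%classic : set R).
Variables (Phis : 'I_n -> R -> R) (Phi Psi : R -> R).
Hypotheses (n_gt0 : (0 < n)%N) (alpha0 : 0 <= alpha).
Hypothesis Phis_U : forall i, class_U (Phis i).
Hypothesis Phi_bij : set_bij Rplus Rplus Phi.
Hypothesis Phi_inv : forall t, 0 <= t ->
  inv_growth Phi t = \prod_(i < n) inv_growth (Phis i) t.
Hypothesis PsiPhi : forall s t, 0 < s -> s <= t -> Psi s / Phi s <= Psi t / Phi t.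
Hypothesis Psi_U : class_U Psi.
Variables (q c : R).
Hypotheses (q1 : 1 <= q) (c0 : 0 < c).
Hypothesis Psi_q : forall t, 0 <= t -> t `^ q <= c * Psi t /\ Psi t <= c * t `^ q.
Variables K D : 'I_n -> R.
Hypothesis K1 : forall j, 1 < K j.
Hypothesis HK : forall j t, 0 < t ->
  2 * (Phis j t / t) <= Phis j (K j * t) / (K j * t).
Hypothesis D0 : forall j, 0 < D j.
Hypothesis HD : forall j t, 0 < t -> Phis j (2 * K j * t) <= D j * Phis j t.
Local Notation leb := (lebesgue_rV R d).
Local Notation T := (lebesgue_type R d).
Variables omega sigma : 'rV[R]_d -> R.
Hypotheses (w_omega : weight omega) (w_sigma : weight sigma).
Local Notation s := (fun x : T => `|sigma x|).
Local Notation w := (fun x : T => `|omega x|).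
Local Notation ws := (wintegral leb s).
Local Notation ww := (wintegral leb w).
Local Notation normc := ComplexField.Normc.normc.

Let ms : measurable_fun setT s := measurable_abs_weight w_sigma.
Let mw : measurable_fun setT w := measurable_abs_weight w_omega.
Let s0 x : 0 <= s x. Proof. exact: normr_ge0. Qed.
Let w0 x : 0 <= w x. Proof. exact: normr_ge0. Qed.

(** The constant of [carleson_embedding]. *)
Definition carleson_const : R :=
  (2 ^+ n) `^ q * (c ^+ 2 * (2 ^+ n) `^ q) * (2 * \sum_(j < n) 2 * D j).

(** The factor [6^(d n)] is lost in replacing a cube by a grid cube, [2] in passing
    from a supremum to one of the values close to it, and the number of grids in
    replacing a maximum over the grids by a sum. *)
Definition sufficiency_const : R :=
  c * (2 * 6 ^+ (d * n)) `^ q * #|{ffun 'I_d -> bool}|%:R *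
  (carleson_const * c ^+ 2).

Variable S0 : R.
Hypothesis S00 : 0 <= S0.
Hypothesis HS : (sawyer_const alpha Phis Phi Psi sigma omega <= S0%:E)%E.

Variables (f : 'I_n -> 'rV[R]_d -> R[i]) (lam : 'I_n -> R).
Hypotheses (cmf : forall j, cmeasurable (f j)) (lam0 : forall j, 0 < lam j).
Hypothesis f1 : forall j, (\int[leb]_x (er_map (Phis j)
  ((lam j)^-1%:E * cabs (f j) x) * (sigma x)%:E) <= 1)%E.

Let g j (x : T) := normc (f j x) / lam j.

Let g0 j x : 0 <= g j x.
Proof. by rewrite divr_ge0 ?normc_ge0// ltW. Qed.

Let mg j : measurable_fun setT (g j).
Proof.
by apply: measurable_funM; [exact: measurable_normc|exact: measurable_cst].
Qed.

Let g1 j : (ws (Phis j \o g j) <= 1)%E.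
Proof.
apply: le_trans (f1 j); apply: ae_le_integral.
  apply: ae_imply (abs_weightE w_sigma) => x -> _.
  by rewrite /= /g EFinM [normc _ / _]mulrC.
apply: ae_imply (abs_weightE w_sigma) => x E _; rewrite -E.
apply: mule_ge0; last by rewrite lee_fin.
apply: er_map_ge0 => [t|]; first exact: class_U_ge0.
by apply: mule_ge0; rewrite lee_fin ?normc_ge0// invr_ge0 ltW.
Qed.

Let mG t i : measurable (@grid R d t i).
Proof. exact: measurable_half_open_cube. Qed.

Lemma grid_masses : exists sG : ('I_d -> bool) -> nat -> R,
  (forall t i, 0 < sG t i) /\
  (forall t i, ws \1_(@grid R d t i) = (sG t i)%:E).
Proof.
have H (ti : ('I_d -> bool) * nat) : exists m : R,
    0 < m /\ ws \1_(@grid R d ti.1 ti.2) = m%:E.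
  by have [m] := mass_grid w_sigma ti.1 ti.2; exists m.
have /choice[m Hm] := H.
by exists (fun t i => m (t, i)); split=> t i; have [] := Hm (t, i).
Qed.

Lemma grid_averages : exists fG : ('I_d -> bool) -> 'I_n -> nat -> R,
  forall t j i, ws (fun x => \1_(@grid R d t i) x * g j x) = (fG t j i)%:E.
Proof.
have [sG [sG0 sGE]] := grid_masses.
exists (fun t j i => fine (ws (fun x => \1_(@grid R d t i) x * g j x))) => t j i.
have W0 : (0 <= ws (fun x => \1_(@grid R d t i) x * g j x)%R)%E.
  by apply: wintegral_ge0 => // x; rewrite mulr_ge0 ?indic_ge0.
rewrite fineK// ge0_fin_numE//.
have := @average_le _ T R leb s ms s0 'I_1 (fun=> grid t i) (fun=> sG t i)
  (fun=> mG t i) (fun=> sG0 t i) (fun=> sGE t i) (Phis j) (g j) ord0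
  (Phis_U j) (g0 j) (mg j) (g1 j).
by move=> /le_lt_trans; apply; rewrite ltry.
Qed.

Section with_averages.
Variables (sG : ('I_d -> bool) -> nat -> R) (fG : ('I_d -> bool) -> 'I_n -> nat -> R).
Hypotheses (sG0 : forall t i, 0 < sG t i)
  (sGE : forall t i, ws \1_(@grid R d t i) = (sG t i)%:E).
Hypothesis fGE : forall t j i,
  ws (fun x => \1_(@grid R d t i) x * g j x) = (fG t j i)%:E.

Local Notation vol i := ((grid_side d i : R) ^+ d).
Let vol0 i : 0 < vol i. Proof. by rewrite exprn_gt0// grid_side_gt0. Qed.

Definition dyadic_coef t i : R :=
  (vol i) `^ (alpha / d%:R) * \prod_(j < n) (fG t j i / vol i).

Definition dyadic_max t N (x : T) : R :=
  \big[Num.max/0]_(i < N) (dyadic_coef t i * \1_(grid t i) x).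

Lemma dyadic_max_bound t N :
  (ww (fun x => (dyadic_max t N x) `^ q)%R <= (carleson_const * (c ^+ 2 * S0))%:E)%E.
Proof.
pose b (i : 'I_N) := (vol i) `^ (alpha / d%:R) * (sG t i / vol i) ^+ n.
have b0 i : 0 <= b i by rewrite mulr_ge0 ?powR_ge0// exprn_ge0// divr_ge0// ltW.
have cS0 : 0 <= c ^+ 2 * S0 by rewrite mulr_ge0// sqr_ge0.
have test (r : 'I_N) : (ww (fun x =>
    (\big[Num.max/0]_(i < N | `[< @grid R d t i `<=` grid t r >])
    (b i * \1_(grid t i) x)) `^ q)%R <=
    (c ^+ 2 * S0 / (inv_growth Phi (sG t r)^-1) `^ q)%:E)%E.
  exact: (testing_grid Phis_U Phi_bij Phi_inv Psi_U q1 c0 Psi_q w_omega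
    w_sigma r S00 (fun i : 'I_N => sGE t i) (fun i : 'I_N => sG0 t i) HS).
have nest (i k : 'I_N) x : @grid R d t i x -> @grid R d t k x ->
    @grid R d t i `<=` grid t k \/ @grid R d t k `<=` grid t i.
  exact: grid_nested.
have coefE (i : 'I_N) : dyadic_coef t i =
    b i * \prod_(j < n) (fG t j i / sG t i).
  rewrite /b /dyadic_coef -mulrA; congr (_ * _).
  have -> : (sG t i / vol i) ^+ n = \prod_(j < n) (sG t i / vol i).
    by rewrite prodr_const card_ord.
  rewrite -big_split /=; apply: eq_bigr => j _.
  by field; rewrite !gt_eqF.
have E : (fun x => (dyadic_max t N x) `^ q) = (fun x : T => (\big[Num.max/0]_(i < N)
    (b i * \prod_(j < n) (fG t j i / sG t i) * \1_(grid t i) x)) `^ q).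
  apply/funext => x; rewrite /dyadic_max.
  by under eq_bigr do rewrite coefE.
rewrite E.
exact: (carleson_embedding ms s0 mw w0 (fun i : 'I_N => mG t i) nest
  (fun i : 'I_N => sG0 t i) (fun i : 'I_N => sGE t i) n_gt0 Phis_U Phi_bij Phi_inv
  PsiPhi q1 c0 Psi_q K1 HK D0 HD g0 mg g1 (fun j (i : 'I_N) => fGE t j i) b0 cS0 test).
Qed.

(** The grid cube that contains [cube a l] has side at most [6 l]. *)
Lemma cube_term_le (a : 'rV[R]_d) (l : R) x : 0 < l -> cube a l x ->
  exists (t : {ffun 'I_d -> bool}) i, grid t i x /\
  (((l ^+ d) `^ (alpha / d%:R))%:E *
    \prod_(j < n) (((l ^+ d)^-1)%:E * \int[leb]_(y in cube a l)
       cabs (fun y => (sigma y)%:C%C * f j y)%R y) <=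
   (6 ^+ (d * n) * \prod_(j < n) lam j * dyadic_coef t i)%:E)%E.
Proof.
move=> l0 Qx; have [t [i [QG lL L6]]] := cube_sub_grid a l0.
exists t, i; split; first exact: QG.
have ld0 : 0 < l ^+ d by exact: exprn_gt0.
have L0 : 0 < (grid_side d i : R) by exact: grid_side_gt0.
have volle : l ^+ d <= vol i.
  by apply: lerXn2r; rewrite ?nnegrE ?(ltW l0) ?(ltW L0).
have vol6 : vol i <= 6 ^+ d * l ^+ d.
  by rewrite -exprMn; apply: lerXn2r; rewrite ?nnegrE ?mulr_ge0 ?(ltW L0) ?(ltW l0).
have -> : 6 ^+ (d * n) * \prod_(j < n) lam j * dyadic_coef t i =
    (vol i) `^ (alpha / d%:R) * \prod_(j < n) (6 ^+ d / vol i * (lam j * fG t j i)).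
  rewrite /dyadic_coef mulrCA; congr (_ * _).
  have -> : 6 ^+ (d * n) = \prod_(j < n) (6 ^+ d : R).
    by rewrite prodr_const card_ord exprM.
  rewrite -!big_split /=; apply: eq_bigr => j _.
  by field; rewrite gt_eqF.
rewrite EFinM; apply: lee_pmul.
- by rewrite lee_fin powR_ge0.
- apply: prode_ge0 => j _; apply: mule_ge0; first by rewrite lee_fin invr_ge0 ltW.
  by apply: integral_ge0 => y _; rewrite lee_fin normc_ge0.
- rewrite lee_fin; apply: ge0_ler_powR => //; first by rewrite divr_ge0.
  + by rewrite nnegrE ltW.
  + by rewrite nnegrE ltW.
rewrite -prodEFin; apply: lee_prod => j _.
  apply: mule_ge0; first by rewrite lee_fin invr_ge0 ltW.
  by apply: integral_ge0 => y _; rewrite lee_fin normc_ge0.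
rewrite EFinM; apply: lee_pmul.
- by rewrite lee_fin invr_ge0 ltW.
- by apply: integral_ge0 => y _; rewrite lee_fin normc_ge0.
- by rewrite lee_fin ler_pdivlMr// mulrC ler_pdivrMr.
have I0 y : 0 <= (\1_(@grid R d t i) y : R) * g j y by rewrite mulr_ge0 ?indic_ge0.
have mI : measurable_fun setT (fun y => (\1_(@grid R d t i) y : R) * g j y).
  by apply: measurable_funM; [exact: measurable_indic|exact: mg].
rewrite EFinM -fGE -(wintegralZ leb ms s0 (ltW (lam0 j)) I0 mI).
rewrite /wintegral [leLHS]integral_mkcond; apply: le_integral_pointwise => y _; last first.
  by rewrite lee_fin mulr_ge0// mulr_ge0// ltW.
rewrite patchE; case: ifPn => [/set_mem Qy|_]; last first.
  by rewrite lee_fin mulr_ge0// mulr_ge0// ltW.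
rewrite indic1; last exact: QG.
rewrite /cabs ComplexField.Normc.normcM normc_real lee_fin mul1r.
rewrite /g [lam j * _]mulrC divfK ?gt_eqF//.
by rewrite mulrC.
Qed.

Lemma fracmax_gt_dyadic (y : R) x : 0 <= y ->
  (y%:E < scaled_fracmax alpha sigma f x)%E ->
  exists (t : {ffun 'I_d -> bool}) N,
    y < 6 ^+ (d * n) * \prod_(j < n) lam j * dyadic_max t N x.
Proof.
move=> y0 /(fracmax_gt y0) /(_ n_gt0)[a [l [l0 Qx yQ]]].
have [t [i [Gx le]]] := cube_term_le l0 Qx.
exists t, i.+1; rewrite -lte_fin; apply: lt_le_trans yQ _; apply: le_trans le _.
rewrite lee_fin ler_wpM2l ?mulr_ge0 ?exprn_ge0//.
  by apply: prodr_ge0 => j _; exact: ltW.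
have := @le_bigmax0 R 'I_i.+1 xpredT (fun k => dyadic_coef t k * \1_(grid t k) x) ord_max isT.
by rewrite /= indic1// mulr1.
Qed.

End with_averages.

Lemma dyadic_max_le fG t N M x : (N <= M)%N -> dyadic_max fG t N x <= dyadic_max fG t M x.
Proof.
move=> NM; apply: bigmax_le; first exact: bigmax0_ge0.
move=> i _; exact: (@le_bigmax0 R 'I_M xpredT
  (fun k => dyadic_coef fG t k * \1_(grid t k) x) (widen_ord NM i) isT).
Qed.

(** The full maximal function is at most a constant times the supremum of the
    maximal functions of finite families of grid cubes. Monotone convergence
    applies to the latter, which are measurable. *)
Lemma modular_bound kappa : 0 < kappa -> sufficiency_const * S0 <= kappa `^ q ->
  (\int[leb]_x (er_map Psi ((kappa * \prod_(j < n) lam j)^-1%:E *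
     scaled_fracmax alpha sigma f x) * (omega x)%:E) <= 1)%E.
Proof.
move=> k0 Ck.
have [sG [sG0 sGE]] := grid_masses; have [fG fGE] := grid_averages.
pose V (t : {ffun 'I_d -> bool}) N x := dyadic_max fG t N x.
pose Lam := \prod_(j < n) lam j; have Lam0 : 0 < Lam by exact: prodr_gt0.
pose k6 : R := 6 ^+ (d * n); have k60 : 0 < k6 by exact: exprn_gt0.
pose C2 := c * (2 * k6 / kappa) `^ q.
have C20 : 0 < C2 by rewrite mulr_gt0// powR_gt0// divr_gt0// mulr_gt0.
pose H N (x : T) := \sum_(t : {ffun 'I_d -> bool}) C2 * (V t N x) `^ q.
pose h N (x : T) : \bar R := (H N x * w x)%:E.
have q00 : 0 <= q by rewrite (le_trans ler01).
have V0 t N x : 0 <= V t N x by exact: bigmax0_ge0.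
have Vq0 N (t : {ffun 'I_d -> bool}) x : 0 <= (V t N x) `^ q by exact: powR_ge0.
have mVb N (t : {ffun 'I_d -> bool}) : measurable_fun setT (V t N).
  apply: measurable_bigmax => i.
  by apply: measurable_funM; [exact: measurable_cst|exact: measurable_indic].
have mV N (t : {ffun 'I_d -> bool}) : measurable_fun setT (fun x => (V t N x) `^ q).
  exact: (measurableT_comp (measurable_powR q) (mVb N t)).
have mH N : measurable_fun setT (H N).
  apply: measurable_bigsum => t.
  by apply: measurable_funM; [exact: measurable_cst|exact: mV].
have H0 N x : 0 <= H N x by apply: sumr_ge0 => t _; rewrite mulr_ge0// ltW.
have h0 N x : (0 <= h N x)%E by rewrite lee_fin mulr_ge0.
have mh N : measurable_fun setT (h N).
  by apply/measurable_EFinP; exact: (measurable_funM (mH N) mw).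
have nd x : {homo h^~ x : N M / (N <= M)%N >-> (N <= M)%E}.
  move=> N M NM; rewrite lee_fin ler_wpM2r//; apply: ler_sum => t _.
  rewrite ler_pM2l//; apply: ge0_ler_powR; rewrite ?nnegrE//.
  exact: dyadic_max_le.
have int_h N : (\int[leb]_x h N x <= 1)%E.
  have -> : (\int[leb]_x h N x)%E = ww (H N) by [].
  rewrite (wintegral_sum leb mw w0 _ _ (fun _ => ltW C20) (Vq0 N) (mV N)).
  apply: (@le_trans _ _ (\sum_(t : {ffun 'I_d -> bool})
      (C2 * (carleson_const * (c ^+ 2 * S0)))%:E)%E).
    apply: lee_sum => t _; rewrite [leRHS]EFinM; apply: lee_wpmul2l.
      by rewrite lee_fin ltW.
    exact: (dyadic_max_bound sG0 sGE fGE).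
  rewrite sumEFin sumr_const lee_fin.
  have kq0 : 0 < kappa `^ q by exact: powR_gt0.
  have E : (2 * k6 / kappa) `^ q = (2 * k6) `^ q / kappa `^ q.
    rewrite powRM ?invr_ge0 ?mulr_ge0 ?(ltW k60) ?(ltW k0)//.
    by rewrite -[kappa^-1]powR_inv1 ?(ltW k0)// -powRrM mulN1r powRN.
  have {}Ck : sufficiency_const * S0 / kappa `^ q <= 1 by rewrite ler_pdivrMr// mul1r.
  apply: le_trans Ck; rewrite -mulr_natl /sufficiency_const -/k6 /C2 E.
  set m := (#|_|)%:R; rewrite le_eqVlt; apply/orP; left; apply/eqP.
  by field; rewrite gt_eqF.
have claim x : (er_map Psi ((kappa * Lam)^-1%:E * scaled_fracmax alpha sigma f x)
    * (omega x)%:E <= ereal_sup (range (h^~ x)))%E.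
  have supge N : (h N x <= ereal_sup (range (h^~ x)))%E.
    by apply: ereal_sup_ubound; exists N.
  have sup0 : (0 <= ereal_sup (range (h^~ x)))%E by apply: le_trans (supge 0%N).
  have y0 : (0 <= scaled_fracmax alpha sigma f x)%E by exact: fracmax_ge0.
  have kL0 : 0 < (kappa * Lam)^-1 by rewrite invr_gt0 mulr_gt0.
  have P0 : (0 <= er_map Psi ((kappa * Lam)^-1%:E * scaled_fracmax alpha sigma f x))%E.
    apply: er_map_ge0 => [t|]; first exact: class_U_ge0.
    by apply: mule_ge0 => //; rewrite lee_fin ltW.
  apply: (@le_trans _ _ (er_map Psi ((kappa * Lam)^-1%:E * scaled_fracmax alpha sigma f x)
    * (w x)%:E)%E); first by apply: lee_wpmul2l => //; rewrite lee_fin ler_norm.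
  have := w0 x; rewrite le_eqVlt => /predU1P[<-|W0]; first by rewrite mule0.
  have big N t : ((C2 * (V t N x) `^ q * w x)%:E <= h N x)%E.
    rewrite lee_fin ler_wpM2r// /H (bigD1 t)//= lerDl.
    by apply: sumr_ge0 => t' _; rewrite mulr_ge0// ltW.
  have Lk0 : 0 < k6 * Lam by exact: mulr_gt0.
  case Ey : (scaled_fracmax alpha sigma f x) y0 => [r| |] // y0.
    have [r0|r0] := leP r 0.
      have -> : r = 0 by apply/eqP; rewrite eq_le r0 -lee_fin.
      by rewrite mule0 /= (class_U0 Psi_U) mul0e.
    have r2 : 0 < r / 2 by exact: divr_gt0.
    have [|t [N HN]] := fracmax_gt_dyadic fGE (y := r / 2) (x := x) (ltW r2).
      by rewrite Ey lte_fin ltr_pdivrMr// ltr_pMr// ltr1n.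
    apply: le_trans (supge N); apply: le_trans (big N t).
    rewrite -EFinM /= lee_fin ler_wpM2r//.
    have kr0 : 0 <= (kappa * Lam)^-1 * r by rewrite mulr_ge0// ltW.
    have [_ h2] := Psi_q kr0; apply: (le_trans h2).
    rewrite /C2 -mulrA ler_pM2l// -powRM//; last by rewrite ltW// divr_gt0// mulr_gt0.
    have kV0 : 0 <= 2 * k6 / kappa * V t N x.
      by rewrite mulr_ge0// ltW// divr_gt0// mulr_gt0.
    apply: ge0_ler_powR; rewrite ?nnegrE//.
    have -> : 2 * k6 / kappa * V t N x = (kappa * Lam)^-1 * (2 * (k6 * Lam * V t N x)).
      by field; rewrite !gt_eqF.
    rewrite ler_pM2l//; move: HN; rewrite -/Lam -/k6 -/(V t N x).
    by rewrite ltr_pdivrMr// mulrC => /ltW.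
  rewrite mulry gtr0_sg// mul1e /= mulyr gtr0_sg// mul1e leye_eq.
  apply/eqP; case Es : (ereal_sup _) sup0 => [B| |] // B0.
  have CW : 0 < C2 * w x by exact: mulr_gt0.
  pose m := 1 + B / (C2 * w x).
  have Bm : 0 <= B / (C2 * w x) by rewrite divr_ge0 ?(ltW CW)// -lee_fin.
  have m1 : 1 <= m by rewrite lerDl.
  have km : 0 <= k6 * Lam * m by rewrite mulr_ge0 ?(ltW Lk0)// (le_trans ler01).
  have [|t [N HN]] := fracmax_gt_dyadic fGE (y := k6 * Lam * m) (x := x) km.
    by rewrite Ey ltry.
  move: HN; rewrite -/Lam -/k6 -/(V t N x) ltr_pM2l// => mV'.
  have V1 : 1 <= V t N x by rewrite (le_trans m1)// ltW.
  have Vq : V t N x <= (V t N x) `^ q by rewrite -[leLHS]powRr1// ler_powR.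
  have := le_trans (big N t) (supge N); rewrite Es lee_fin leNgt => /negP; case.
  have E : B = C2 * (m - 1) * w x.
    by rewrite /m addrC addKr; field; rewrite !gt_eqF.
  rewrite [ltLHS]E ltr_pM2r// ltr_pM2l// (lt_le_trans _ Vq)// (le_lt_trans _ mV')//.
  by rewrite lerBlDr lerDl.
have limE x : limn (h^~ x) = ereal_sup (range (h^~ x)).
  by apply/cvg_lim => //; apply: ereal_nondecreasing_cvgn; exact: nd.
apply: (@le_trans _ _ (\int[leb]_x limn (h^~ x))%E).
  apply: le_integral_pointwise => x _; rewrite limE //.
  by apply: le_trans (h0 0%N x) _; apply: ereal_sup_ubound; exists 0%N.
rewrite monotone_convergence//; apply: lime_le; last by apply: nearW.
apply: ereal_nondecreasing_is_cvgn => N M NM.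
by apply: le_integral_pointwise => x _; [exact: nd|exact: h0].
Qed.

End sufficiency.

(** * Luxemburg norms and necessity *)

Section luxemburg_norms.
Context {R : realType} (d : nat).
Local Notation leb := (lebesgue_rV R d).
Implicit Types (F : R -> R) (sigma : 'rV[R]_d -> R) (g : 'rV[R]_d -> \bar R).

Lemma luxemburg_ge0 F sigma g : (0 <= luxemburg F sigma g)%E.
Proof. by apply: le_ereal_inf_tmp => _ [lam [lam0 _] <-]; rewrite lee_fin ltW. Qed.

Lemma luxemburg_le F sigma g (lam : R) : 0 < lam ->
  (\int[leb]_x (er_map F ((lam^-1)%:E * g x) * (sigma x)%:E) <= 1)%E ->
  (luxemburg F sigma g <= lam%:E)%E.
Proof. by move=> lam0 H; apply: ereal_inf_lbound; exists lam. Qed.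

Lemma luxemburg_lt F sigma g (m : R) : (luxemburg F sigma g < m%:E)%E ->
  exists lam, [/\ 0 < lam, lam < m &
  (\int[leb]_x (er_map F ((lam^-1)%:E * g x) * (sigma x)%:E) <= 1)%E].
Proof.
by move=> /ereal_inf_lt[_ [lam [lam0 H] <-]]; rewrite lte_fin => lm; exists lam.
Qed.

(** A quantitative form of the continuity of the product, used to let [e] tend
    to [0] in a product of Luxemburg norms, each of which is only approached by
    admissible constants. *)
Lemma prod_add_le n (l : 'I_n -> R) e : (forall j, 0 <= l j) -> 0 <= e <= 1 ->
  \prod_(j < n) (l j + e) <= \prod_(j < n) l j + e * \prod_(j < n) (l j + 2).
Proof.
move=> l0 /andP[e0 e1]; elim: n l l0 => [|n IH] l l0.
  by rewrite !big_ord0 lerDl mulr1.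
rewrite !big_ord_recl /=.
have {IH} := IH (fun j => l (lift ord0 j)) (fun j => l0 _).
set P := \prod_(j < n) l _; set C := \prod_(j < n) (_ + 2).
have P0 : 0 <= P by exact: prodr_ge0.
have PC : P <= C by apply: ler_prod => j _; rewrite (l0 (lift ord0 j)) /= lerDl ler0n.
have := l0 ord0; set x := l ord0 => x0 H.
have xe0 : 0 <= x + e by rewrite addr_ge0.
apply: le_trans (ler_wpM2l xe0 H) _.
have C0 : 0 <= C := le_trans P0 PC.
rewrite -subr_ge0.
have -> : x * P + e * ((x + 2) * C) - (x + e) * (P + e * C) =
    e * ((C - P) + (1 - e) * C) by ring.
apply: mulr_ge0 => //; apply: addr_ge0; first by rewrite subr_ge0.
by apply: mulr_ge0 => //; rewrite subr_ge0.
Qed.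

End luxemburg_norms.

Section necessity.
Context {R : realType} (n d : nat) (alpha : R).
Local Notation Rplus := (`[0, +oo[%classic : set R).
Variables (Phis : 'I_n -> R -> R) (Phi Psi : R -> R).
Hypothesis Phis_U : forall i, class_U (Phis i).
Hypothesis Phi_bij : set_bij Rplus Rplus Phi.
Hypothesis Phi_inv : forall t, 0 <= t ->
  inv_growth Phi t = \prod_(i < n) inv_growth (Phis i) t.
Hypothesis Psi_U : class_U Psi.
Variables (q c : R).
Hypotheses (q1 : 1 <= q) (c0 : 0 < c).
Hypothesis Psi_q : forall t, 0 <= t -> t `^ q <= c * Psi t /\ Psi t <= c * t `^ q.
Local Notation leb := (lebesgue_rV R d).
Local Notation T := (lebesgue_type R d).
Variables omega sigma : 'rV[R]_d -> R.
Hypotheses (w_omega : weight omega) (w_sigma : weight sigma).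
Local Notation s := (fun x : T => `|sigma x|).
Local Notation w := (fun x : T => `|omega x|).

(** At the constant [1 / Phi_j^-1 (1 / m)] the modular of the indicator function is
    exactly [(1 / m) m]. *)
Lemma luxemburg_cube (a : 'rV[R]_d) (l m : R) j : 0 < l -> 0 < m ->
  (\int[leb]_(x in cube a l) (s x)%:E = m%:E)%E ->
  (luxemburg (Phis j) sigma (cabs (fun x => (\1_(cube a l) x)%:C%C)) <=
   ((inv_growth (Phis j) m^-1)^-1)%:E)%E.
Proof.
move=> l0 m0 mE; set v := inv_growth _ _.
have mi0 : 0 < m^-1 by rewrite invr_gt0.
have v0 : 0 < v by exact: inv_class_U_gt0.
have mC : measurable (cube a l : set T) by exact: measurable_cube.
have ms : measurable_fun setT s := measurable_abs_weight w_sigma.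
apply: luxemburg_le; first by rewrite invr_gt0.
rewrite invrK.
apply: (@le_trans _ _ (wintegral leb s (fun x => m^-1 * \1_(cube a l) x))).
  apply: ae_le_integral.
    apply: ae_imply (abs_weightE w_sigma) => x E _; rewrite E.
    rewrite /cabs normc_real -EFinM /= EFinM lee_fin indicE.
    case: (x \in _); rewrite ?normr1 ?normr0 ?mulr1 ?mulr0.
      by rewrite inv_growthK ?(ltW mi0)//; exact: class_U_bij.
    by rewrite class_U0// mul0r.
  by apply: aeW => x _; rewrite lee_fin !mulr_ge0 ?(ltW mi0).
have s0 (x : T) : 0 <= s x by exact: normr_ge0.
have I0 (x : T) : 0 <= (\1_(cube a l) x : R) by exact: (@indic_ge0 _ T).
have mI : measurable_fun setT (\1_(cube a l : set T) : T -> R) by exact: measurable_indic.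
rewrite (wintegralZ leb ms s0 (ltW mi0) I0 mI) wintegral_indic//.
by rewrite mE -EFinM mulVf// gt_eqF.
Qed.

(** Test on the indicator functions of a cube, for which [scaled_fracmax] is the
    function in the Sawyer constant. The operator bound controls the modular of
    this function divided by [lam], and the power behaviour of [Psi] takes [lam]
    out of the integral. *)
Lemma necessity kappa :
  operator_bounds (@scaled_fracmax R d n alpha sigma) Phis sigma Psi omega kappa ->
  (sawyer_const alpha Phis Phi Psi sigma omega <=
     (c ^+ 3 * 2 `^ q * kappa `^ q)%:E)%E.
Proof.
move=> [k0 HB]; apply: ge_ereal_sup => _ [_ [a [l [l0 ->]]] <-].
have mC : measurable (cube a l : set T) by exact: measurable_cube.
have ms : measurable_fun setT s := measurable_abs_weight w_sigma.
have [m m0 mE] : exists2 m : R, 0 < m &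
    (\int[leb]_(x in cube a l) (s x)%:E = m%:E)%E.
  have fin := weight_cube_fin w_sigma a l.
  have pos : (0 < \int[leb]_(x in cube a l) (s x)%:E)%E.
    have mes : measurable_fun setT (fun x => (s x)%:E) by exact/measurable_EFinP.
    have s0 (x : T) : (0 <= (s x)%:E)%E by rewrite lee_fin.
    rewrite (integral_cube_half_open a l0 mes s0).
    exact: (weight_half_open_gt0 w_sigma a l0).
  exists (fine (\int[leb]_(x in cube a l) (s x)%:E)); first by rewrite fine_gt0// pos.
  by rewrite fineK// ge0_fin_numE// ltW.
rewrite (nu_mass Phi_bij Phi_inv w_sigma) mE /= div1r.
set v := inv_growth Phi _.
have v0 : 0 < v by apply: (inv_product_gt0 Phis_U Phi_inv); rewrite invr_gt0.
pose f (_ : 'I_n) (x : 'rV[R]_d) : R[i] := (\1_(cube a l) x)%:C%C.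
have lux_f j : (luxemburg (Phis j) sigma (cabs (f j)) <=
    ((inv_growth (Phis j) m^-1)^-1)%:E)%E by exact: luxemburg_cube.
have orl j : orlicz (Phis j) sigma (f j).
  split; last by apply: le_lt_trans (lux_f j) _; rewrite ltry.
  split; first exact: (@measurable_indic _ T).
  exact: measurable_cst.
pose M x := scaled_fracmax alpha sigma f x.
have -> : fracmax alpha (fun (_ : 'I_n) y => (sigma y * \1_(cube a l) y)%:C%C) = M.
  rewrite /M /scaled_fracmax; congr (fracmax alpha _).
  by apply/funext => j; apply/funext => y; rewrite /f rmorphM.
have luxM : (luxemburg Psi omega M < (2 * kappa / v)%:E)%E.
  apply: le_lt_trans (HB f orl) _.
  apply: (@le_lt_trans _ _ (kappa%:E * \prod_(j < n) ((inv_growth (Phis j) m^-1)^-1)%:E)%E).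
    apply: lee_wpmul2l; first by rewrite lee_fin ltW.
    by apply: lee_prod => j _; [exact: luxemburg_ge0|exact: lux_f].
  rewrite prodEFin -EFinM lte_fin prodfV -Phi_inv ?invr_ge0 ?(ltW m0)// -/v.
  by rewrite ltr_pM2r ?invr_gt0// ltr_pMl// ltr1n.
have [lam [lam0 lamk Hlam]] := luxemburg_lt luxM.
have M0 x : (0 <= M x)%E by exact: fracmax_ge0.
pose G x := (er_map Psi ((lam^-1)%:E * M x) * (w x)%:E)%E.
have G0 x : (0 <= G x)%E.
  apply: mule_ge0; last by rewrite lee_fin.
  apply: er_map_ge0 => [t|]; first exact: class_U_ge0.
  by apply: mule_ge0 => //; rewrite lee_fin invr_ge0 ltW.
have k20 : 0 < c ^+ 2 * lam `^ q by rewrite mulr_gt0 ?exprn_gt0// powR_gt0.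
have scale x : (er_map Psi (M x) <=
    (c ^+ 2 * lam `^ q)%:E * er_map Psi ((lam^-1)%:E * M x))%E.
  case: (M x) (M0 x) => [y| |] // y0; last first.
    rewrite mulry gtr0_sg ?invr_gt0// mul1e /=.
    by rewrite mulry gtr0_sg// mul1e.
  rewrite lee_fin in y0; rewrite -EFinM /= lee_fin.
  have ly0 : 0 <= lam^-1 * y by rewrite mulr_ge0// invr_ge0 ltW.
  have [_ h2] := Psi_q y0; have [h1 _] := Psi_q ly0.
  apply: (le_trans h2); rewrite expr2 -!mulrA ler_pM2l// mulrCA.
  have -> : y `^ q = lam `^ q * (lam^-1 * y) `^ q.
    by rewrite -powRM ?(ltW lam0)// mulVKf// gt_eqF.
  by rewrite ler_pM2l// powR_gt0.
have intG : (\int[leb]_(x in cube a l) (er_map Psi (M x) * (omega x)%:E) <=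
    (c ^+ 2 * lam `^ q)%:E)%E.
  apply: (@le_trans _ _ (\int[leb]_(x in cube a l) ((c ^+ 2 * lam `^ q)%:E * G x))%E).
    apply: le_integral_pointwise => x _; last by apply: mule_ge0 => //; rewrite lee_fin ltW.
    apply: (@le_trans _ _ (er_map Psi (M x) * (w x)%:E)%E).
      apply: lee_wpmul2l; last by rewrite lee_fin ler_norm.
      by apply: er_map_ge0 => // t; exact: class_U_ge0.
    by rewrite /G muleA; apply: lee_wpmul2r => //; rewrite lee_fin.
  apply: le_trans (ge0_integralZl_le leb k20 _) _ => //.
  rewrite -[leRHS]mule1; apply: lee_wpmul2l; first by rewrite lee_fin ltW.
  apply: le_trans Hlam; rewrite integral_mkcond.
  apply: ae_le_integral.
    apply: ae_imply (abs_weightE w_omega) => x E _; rewrite -E -/(G x) patchE.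
    by case: ifP.
  by apply: ae_imply (abs_weightE w_omega) => x E _; rewrite -E; exact: G0.
have Pv0 : 0 < Psi v by exact: class_U_gt0.
apply: le_trans (lee_wpmul2l _ intG) _; first by rewrite lee_fin ltW.
rewrite -EFinM lee_fin.
have [_ h] := Psi_q (ltW v0).
apply: (@le_trans _ _ (c * v `^ q * (c ^+ 2 * lam `^ q))).
  by rewrite ler_wpM2r// ltW.
have -> : c * v `^ q * (c ^+ 2 * lam `^ q) = c ^+ 3 * (v * lam) `^ q.
  by rewrite powRM ?(ltW v0) ?(ltW lam0)//; ring.
rewrite -[leRHS]mulrA -powRM ?(ltW k0)// ler_pM2l ?exprn_gt0//.
apply: ge0_ler_powR; rewrite ?(le_trans ler01)// ?nnegrE.
- by rewrite mulr_ge0// ltW.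
- by rewrite mulr_ge0// ltW.
by rewrite mulrC -ler_pdivlMr// ltW.
Qed.

End necessity.

(** * The two-weight characterization *)

Section sufficiency_bound.
Context {R : realType} (n d : nat) (alpha : R).
Local Notation Rplus := (`[0, +oo[%classic : set R).
Variables (Phis : 'I_n -> R -> R) (Phi Psi : R -> R).
Hypotheses (n_gt0 : (0 < n)%N) (alpha0 : 0 <= alpha).
Hypothesis Phis_U : forall i, class_U (Phis i).
Hypothesis Phi_bij : set_bij Rplus Rplus Phi.
Hypothesis Phi_inv : forall t, 0 <= t ->
  inv_growth Phi t = \prod_(i < n) inv_growth (Phis i) t.
Hypothesis PsiPhi : forall s t, 0 < s -> s <= t -> Psi s / Phi s <= Psi t / Phi t.
Hypothesis Psi_U : class_U Psi.
Variables (q c : R).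
Hypotheses (q1 : 1 <= q) (c0 : 0 < c).
Hypothesis Psi_q : forall t, 0 <= t -> t `^ q <= c * Psi t /\ Psi t <= c * t `^ q.
Variables K D : 'I_n -> R.
Hypothesis K1 : forall j, 1 < K j.
Hypothesis HK : forall j t, 0 < t ->
  2 * (Phis j t / t) <= Phis j (K j * t) / (K j * t).
Hypothesis D0 : forall j, 0 < D j.
Hypothesis HD : forall j t, 0 < t -> Phis j (2 * K j * t) <= D j * Phis j t.
Variables omega sigma : 'rV[R]_d -> R.
Hypotheses (w_omega : weight omega) (w_sigma : weight sigma).

(** [modular_bound] applies to all constants [lam j] that are admissible in the
    Luxemburg norm of [f j]; then let them tend to these norms. *)
Lemma sufficiency S0 kappa : 0 <= S0 ->
  (sawyer_const alpha Phis Phi Psi sigma omega <= S0%:E)%E ->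
  0 < kappa -> sufficiency_const d q c D * S0 <= kappa `^ q ->
  operator_bounds (@scaled_fracmax R d n alpha sigma) Phis sigma Psi omega kappa.
Proof.
move=> S00 HS k0 Ck; split=> // f orl.
have fin j : exists2 l : R, 0 <= l & luxemburg (Phis j) sigma (cabs (f j)) = l%:E.
  have [_ fy] := orl j.
  have f0 : (0 <= luxemburg (Phis j) sigma (cabs (f j)))%E.
    exact: luxemburg_ge0.
  exists (fine (luxemburg (Phis j) sigma (cabs (f j)))); first exact: fine_ge0.
  by rewrite fineK// ge0_fin_numE.
have /choice[l Hl] j : exists l : R,
    0 <= l /\ luxemburg (Phis j) sigma (cabs (f j)) = l%:E.
  by have [l] := fin j; exists l.
have l0 j : 0 <= l j by have [] := Hl j.
under eq_bigr => j _ do rewrite (Hl j).2.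
rewrite prodEFin -EFinM.
have main e : 0 < e -> (luxemburg Psi omega (scaled_fracmax alpha sigma f) <=
    (kappa * \prod_(j < n) (l j + e))%:E)%E.
  move=> e0.
  have /choice[lam Hlam] j : exists lam, [/\ 0 < lam, lam < l j + e &
    (\int[lebesgue_rV R d]_x (er_map (Phis j) ((lam^-1)%:E * cabs (f j) x)
       * (sigma x)%:E) <= 1)%E].
    by apply: luxemburg_lt; rewrite (Hl j).2 lte_fin ltrDl.
  have lam0 j : 0 < lam j by have [] := Hlam j.
  apply: (@le_trans _ _ (kappa * \prod_(j < n) lam j)%:E); last first.
    rewrite lee_fin ler_pM2l//; apply: ler_prod => j _.
    by have [h1 h2 _] := Hlam j; rewrite !ltW.
  apply: luxemburg_le; first by rewrite mulr_gt0// prodr_gt0.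
  apply: (modular_bound n_gt0 alpha0 Phis_U Phi_bij Phi_inv PsiPhi Psi_U q1 c0
    Psi_q K1 HK D0 HD w_omega w_sigma S00 HS _ lam0 _ k0 Ck).
    by move=> j; have [] := orl j.
  by move=> j; have [] := Hlam j.
apply/lee_addgt0Pr => eps eps0; rewrite -EFinD.
set C := \prod_(j < n) (l j + 2).
have C0 : 0 < C by apply: prodr_gt0 => j _; rewrite ltr_wpDl.
pose e := Num.min 1 (eps / (kappa * C)).
have kC : 0 < kappa * C by exact: mulr_gt0.
have e0 : 0 < e by rewrite lt_min ltr01 divr_gt0.
apply: le_trans (main _ e0) _; rewrite lee_fin.
have e01 : 0 <= e <= 1 by rewrite ltW// ge_min lexx.
have H := prod_add_le l0 e01.
apply: le_trans (ler_wpM2l (ltW k0) H) _; rewrite mulrDr lerD2l -/C.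
rewrite mulrCA -ler_pdivlMr//.
by rewrite ge_min lexx orbT.
Qed.

Lemma sawyer_ge0 : (0 <= sawyer_const alpha Phis Phi Psi sigma omega)%E.
Proof.
pose Q : set 'rV[R]_d := cube 0 1.
apply: le_ereal_sup_tmp; eexists; first by exists Q; [exists 0, 1|reflexivity].
have m0 : 0 <= fine (weight_measure (nu Phis Phi sigma) Q).
  rewrite fine_ge0// (nu_mass Phi_bij Phi_inv w_sigma).
  by apply: integral_ge0 => x _; rewrite lee_fin.
apply: mule_ge0.
  rewrite lee_fin; apply: class_U_ge0 => //.
  by apply: inv_growth_ge0 => //; rewrite divr_ge0.
rewrite -(integral0 (lebesgue_rV R d) Q); apply: ae_le_integral.
  apply: ae_imply (abs_weightE w_omega) => x E _ /=; rewrite -E.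
  apply: mule_ge0; last by rewrite lee_fin.
  apply: er_map_ge0; last exact: fracmax_ge0.
  by move=> t; exact: class_U_ge0.
apply: ae_imply (abs_weightE w_omega) => x E _ /=; rewrite -E.
apply: mule_ge0; last by rewrite lee_fin.
apply: er_map_ge0; last exact: fracmax_ge0.
by move=> t; exact: class_U_ge0.
Qed.

End sufficiency_bound.

Theorem corollary3p10 (R : realType) (n d : nat) (alpha : R)
  (Phis : 'I_n -> R -> R) (Psi Phi : R -> R)
  (alpha_ge0 : 0 <= alpha) (alpha_lt : alpha < (n * d)%:R)
  (Phis_U : forall i, class_U (Phis i))
  (Phis_normalized : forall i, normalized (Phis i))
  (Phis_nabla2 : forall i, nabla2 (Phis i))
  (Psi_tU : class_tU Psi) (Psi_normalized : normalized Psi)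
  (Phi_bij : set_bij `[0, +oo[ `[0, +oo[ Phi)
  (Phi_inv : forall t, 0 <= t ->
     inv_growth Phi t = \prod_(i < n) inv_growth (Phis i) t)
  (PsiPhi : forall s t, 0 < s -> s <= t -> Psi s / Phi s <= Psi t / Phi t) :
  exists c : R, 0 < c /\
    forall omega sigma : 'rV[R]_d -> R, weight omega -> weight sigma ->
      let S := sawyer_const alpha Phis Phi Psi sigma omega in
      let M := @scaled_fracmax R d n alpha sigma in
      ((S < +oo)%E <-> bounded_operator M Phis sigma Psi omega) /\
      (c^-1%:E * er_map (inv_growth Psi) S
         <= operator_norm M Phis sigma Psi omega
         <= c%:E * er_map (inv_growth Psi) S)%E.
Proof.
have n_gt0 : (0 < n)%N.
  case: n alpha_lt {Phis_U Phis_normalized Phis_nabla2 Phi_inv} Phis => // + _.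
  by rewrite mul0n => /(le_lt_trans alpha_ge0); rewrite ltxx.
have Psi_U := class_tU_class_U Psi_tU.
have [q [c [q1 c0 Psi_q]]] := class_tU_power Psi_tU.
have /choice[K HK] j := nabla2_lower_index (Phis_U j) (Phis_nabla2 j).
have K1 j : 1 < K j by have [] := HK j.
have HK' j t : 0 < t -> 2 * (Phis j t / t) <= Phis j (K j * t) / (K j * t).
  by have [_] := HK j; exact.
have /choice[D HD] j : exists D, 0 < D /\
    forall t, 0 < t -> Phis j (2 * K j * t) <= D * Phis j t.
  apply: class_U_doubling => //; have := K1 j; lra.
have D0 j : 0 < D j by have [] := HD j.
have HD' j t : 0 < t -> Phis j (2 * K j * t) <= D j * Phis j t.
  by have [_] := HD j; exact.
have q0 : 0 < q := lt_le_trans ltr01 q1.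
pose C1 := sufficiency_const d q c D.
pose C2 := c ^+ 3 * 2 `^ q.
have C20 : 0 < C2 by rewrite mulr_gt0 ?exprn_gt0// powR_gt0.
have C10 : 0 <= C1.
  rewrite /C1 /sufficiency_const /carleson_const.
  have SD : 0 <= \sum_(j < n) 2 * D j by apply: sumr_ge0 => j _; rewrite mulr_ge0// ltW.
  by rewrite !mulr_ge0 ?powR_ge0 ?exprn_ge0 ?(ltW c0).
(* The norm lies between [y / B2] and [B1 y] with [y = Psi^-1 S]; adding [1] keeps
   [B1] positive. *)
pose B1 := (C1 * c + 1) `^ q^-1; pose B2 := (c * C2) `^ q^-1.
have C1c : 0 < C1 * c + 1 by rewrite ltr_wpDl// mulr_ge0// ltW.
have B10 : 0 < B1 by exact: powR_gt0.
have B20 : 0 < B2 by rewrite powR_gt0// mulr_gt0.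
have root x : 0 <= x -> (x `^ q^-1) `^ q = x.
  by move=> x0; rewrite -powRrM mulVf ?gt_eqF// powRr1.
have powle x y : 0 <= x -> 0 <= y -> x `^ q <= y `^ q -> x <= y.
  move=> x0 y0; apply: contraTT; rewrite -!ltNge => yx.
  by apply: gt0_ltr_powR; rewrite ?nnegrE.
exists (B1 + B2); split; first exact: addr_gt0.
move=> omega sigma w_omega w_sigma S M.
have S_ge0 : (0 <= S)%E by exact: (sawyer_ge0 _ Phi_bij Phi_inv Psi_U w_omega w_sigma).
have nec k : operator_bounds M Phis sigma Psi omega k -> (S <= (C2 * k `^ q)%:E)%E.
  exact: (necessity Phis_U Phi_bij Phi_inv Psi_U q1 c0 Psi_q w_omega w_sigma).
case ES : S S_ge0 => [S0| |] // S00; last first.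
  have empty k : ~ operator_bounds M Phis sigma Psi omega k.
    by move=> /nec; rewrite ES leye_eq.
  split; first by split=> // -[k /empty].
  have -> : operator_norm M Phis sigma Psi omega = +oo%E.
    have E0 : [set k%:E | k in operator_bounds M Phis sigma Psi omega] = set0.
      by apply/seteqP; split=> // z [k kb _]; case: (empty k kb).
    by rewrite /operator_norm E0 ereal_inf0.
  by rewrite /= !gt0_muley ?lte_fin ?invr_gt0 ?addr_gt0.
rewrite lee_fin in S00; pose y := inv_growth Psi S0.
have Psi_bij := class_U_bij Psi_U.
have y0 : 0 <= y by exact: inv_growth_ge0.
have Py : Psi y = S0 by exact: inv_growthK.
have [y1 y2] := Psi_q _ y0; rewrite Py in y1 y2.
have HS : (S <= S0%:E)%E by rewrite ES.
have suf k : 0 < k -> C1 * S0 <= k `^ q -> operator_bounds M Phis sigma Psi omega k.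
  exact: (sufficiency n_gt0 alpha_ge0 Phis_U Phi_bij Phi_inv PsiPhi Psi_U q1 c0
    Psi_q K1 HK' D0 HD' w_omega w_sigma S00 HS).
have sufe e : 0 < e -> operator_bounds M Phis sigma Psi omega (B1 * y + e).
  move=> e0; have By : 0 <= B1 * y by rewrite mulr_ge0// ltW.
  apply: suf; first by rewrite ltr_wpDl.
  apply: (@le_trans _ _ ((B1 * y) `^ q)); last first.
    apply: ge0_ler_powR; rewrite ?(ltW q0) ?nnegrE ?addr_ge0 ?(ltW e0)//.
    by rewrite lerDl ltW.
  rewrite powRM ?(ltW B10)// root ?(ltW C1c)//.
  have yq : 0 <= y `^ q by exact: powR_ge0.
  apply: (@le_trans _ _ (C1 * c * y `^ q)).
    by rewrite -mulrA ler_wpM2l.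
  by rewrite ler_wpM2r// lerDl.
split.
  split=> _; last by rewrite ltry.
  by exists (B1 * y + 1); apply: sufe.
rewrite /= -/y; apply/andP; split.
  apply: le_ereal_inf_tmp => _ [k kb <-]; have [k0 _] := kb.
  rewrite -EFinM lee_fin ler_pdivrMl ?addr_gt0//.
  apply: (@le_trans _ _ (B2 * k)); last by rewrite ler_pM2r// lerDr ltW.
  apply: powle => //; first by rewrite mulr_ge0// ltW.
  rewrite powRM ?(ltW B20) ?(ltW k0)// root; last by rewrite ltW// mulr_gt0.
  apply: (le_trans y1); rewrite -mulrA ler_pM2l//.
  by have := nec _ kb; rewrite ES lee_fin.
apply: (@le_trans _ _ (B1 * y)%:E); last first.
  by rewrite -EFinM lee_fin ler_wpM2r// lerDl ltW.
apply/lee_addgt0Pr => e e0; rewrite -EFinD.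
by apply: ereal_inf_lbound; exists (B1 * y + e) => //; exact: sufe.
Qed.
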